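(* Let $n\geq5$ and let $\alpha\in\mathbb{R}^n$ be an irrational vector with Diophantine exponent $\omega_\alpha$ and uniform Diophantine exponent $\hat\omega_\alpha$. Assume that $\omega_\alpha<\infty$ and that $\hat\omega_\alpha>\frac{2}{n-2}$. Then for any $\kappa\in\left(0,\frac{(n-2)\hat\omega_\alpha-2}{n(1+\omega_\alpha+\omega_\alpha\hat\omega_\alpha)}\right)$, for any $\xi\in\mathbb{R}$, and for almost every non-degenerate indefinite quadratic form $Q$ in $n$ variables, the system of inequalities $$|Q_\alpha(v)-\xi|<t^{-\kappa},\qquad \|v\|\leq t$$ has solutions $v\in\mathbb{Z}^n$ for all sufficiently large $t$.
   Context: $Q_\alpha(v):=Q(v+\alpha)$; $\|\cdot\|$ is the Euclidean norm. A vector $\alpha\in\mathbb{R}^n$ is irrational if $\alpha\notin\mathbb{Q}^n$. For $\beta\in\mathbb{R}^n$ put $\langle\beta\rangle:=\inf_{v\in\mathbb{Z}^n}\|\beta-v\|_\infty$, with $\|\cdot\|_\infty$ the supremum norm. For irrational $\alpha$, the Diophantine exponent $\omega_\alpha\in(0,\infty]$ (respectively uniform Diophantine exponent $\hat\omega_\alpha$) is the supremum of $\nu>0$ for which the system $\langle q\alpha\rangle<t^{-\nu}$, $|q|<t$ has a nonzero integer solution $q$ for an unbounded set of $t>0$ (respectively for all sufficiently large $t>0$). ''Almost every form'': for $p_1,p_2\geq 1$ with $p_1+p_2=n$, fix a quadratic form $Q_0$ of signature $(p_1,p_2)$ with unit determinant (in absolute value), e.g. $Q_0(v)=\sum_{i\le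 p_1}v_i^2-\sum_{i>p_1}v_i^2$. Every form of signature $(p_1,p_2)$ is of the form $v\mapsto\lambda Q_0(vg)$ with $\lambda>0$, $g\in \mathrm{SL}_n(\mathbb{R})$ (row vectors, right multiplication). A property holds for almost all forms of signature $(p_1,p_2)$ if for every $\lambda>0$ it holds for $\lambda Q_0(vg)$ for Haar-almost every $g\in\mathrm{SL}_n(\mathbb{R})$; it holds for almost every non-degenerate indefinite form in $n$ variables if it holds for almost all forms of signature $(p_1,p_2)$ for all $p_1,p_2\geq1$ with $p_1+p_2=n$. *)

(* Defs.v *)
From HB Require Import structures.
From mathcomp Require Import all_boot all_order all_algebra.
From mathcomp Require Import all_classical all_reals all_analysis.

Set Implicit Arguments.
Unset Strict Implicit.
Unset Printing Implicit Defensive.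

Import Order.TTheory GRing.Theory Num.Theory.
Import numFieldNormedType.Exports.

Local Open Scope classical_set_scope.
Local Open Scope ring_scope.

Section Vectors.
Context {R : realType} {n : nat}.

Definition l2norm (v : 'rV[R]_n) : R := Num.sqrt (\sum_(i < n) v 0 i ^+ 2).

Definition of_int (v : 'rV[int]_n) : 'rV[R]_n := map_mx intr v.

Definition irrational_vector (alpha : 'rV[R]_n) : Prop :=
  ~ (forall i, rational (alpha 0 i)).

(* The norm `|.| of the library on matrices is the supremum norm. *)
Definition dist_lattice (beta : 'rV[R]_n) : R :=
  inf [set `|beta - of_int v| | v in [set: 'rV[int]_n]].

Definition dioph_solvable (alpha : 'rV[R]_n) (nu t : R) : Prop :=
  exists q : int, [/\ q != 0,
    dist_lattice (q%:~R *: alpha) < t `^ (- nu) & `|q%:~R : R| < t].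

(* Both suprema are taken in \bar R, where sup set0 = -oo; for irrational alpha
   the sets are nonempty by Dirichlet's theorem, so the exponents are > 0. *)
Definition dioph_exponent (alpha : 'rV[R]_n) : \bar R :=
  ereal_sup [set nu%:E | nu in [set nu : R | 0 < nu /\
    forall M : R, exists t, [/\ 0 < t, M < t & dioph_solvable alpha nu t]]].

Definition unif_dioph_exponent (alpha : 'rV[R]_n) : \bar R :=
  ereal_sup [set nu%:E | nu in [set nu : R | 0 < nu /\
    \forall t \near +oo, dioph_solvable alpha nu t]].

End Vectors.

Section SpecialLinear.
Context (R : realType) (n : nat).

Record SL := MkSL { SLval :> 'M[R]_n; SL_det : \det SLval == 1 }.

HB.instance Definition _ := [isSub for SLval].
HB.instance Definition _ := [Choice of SL by <:].

Lemma SL_one_subproof : \det (1%:M : 'M[R]_n) == 1.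
Proof. by rewrite det1. Qed.

Lemma SL_mul_subproof (g h : SL) : \det (SLval g *m SLval h) == 1.
Proof. by rewrite det_mulmx (eqP (SL_det g)) (eqP (SL_det h)) mulr1. Qed.

Lemma SL_inv_subproof (g : SL) : \det (invmx (SLval g)) == 1.
Proof. by rewrite det_inv (eqP (SL_det g)) invr1. Qed.

Definition SL_one := MkSL SL_one_subproof.
Definition SL_mul (g h : SL) := MkSL (SL_mul_subproof g h).
Definition SL_inv (g : SL) := MkSL (SL_inv_subproof g).

Lemma SL_unitmx (g : SL) : SLval g \in unitmx.
Proof. by rewrite unitmxE (eqP (SL_det g)) unitr1. Qed.

Lemma SL_mulA : associative SL_mul.
Proof. by move=> g h k; apply: val_inj; rewrite /= mulmxA. Qed.

Lemma SL_mul1 : left_id SL_one SL_mul.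
Proof. by move=> g; apply: val_inj; rewrite /= mul1mx. Qed.

Lemma SL_mulr1 : right_id SL_one SL_mul.
Proof. by move=> g; apply: val_inj; rewrite /= mulmx1. Qed.

Lemma SL_mulV : left_inverse SL_one SL_inv SL_mul.
Proof. by move=> g; apply: val_inj; rewrite /= mulVmx // SL_unitmx. Qed.

Lemma SL_mulrV : right_inverse SL_one SL_inv SL_mul.
Proof. by move=> g; apply: val_inj; rewrite /= mulmxV // SL_unitmx. Qed.

HB.instance Definition _ :=
  isGroup.Build SL SL_mulA SL_mul1 SL_mulr1 SL_mulV SL_mulrV.
HB.instance Definition _ := isPointed.Build SL SL_one.
HB.instance Definition _ := Topological.copy SL (initial_topology SLval).

Definition borelSL := g_sigma_algebraType (@open SL).

(* SL_n(R) is a locally compact second countable Hausdorff group, so regularity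
   follows from finiteness on compact sets and is not required. *)
Definition haar_measure (mu : {measure set borelSL -> \bar R}) : Prop :=
  [/\ forall (g : SL) (A : set borelSL), measurable A ->
        mu [set (g * x)%g | x in (A : set SL)] = mu A,
      forall K : set SL, compact K -> (mu K < +oo)%E
    & mu setT <> 0%E].

(* Haar measure exists and is unique up to a positive factor, so quantifying
   over all Haar measures is the same as choosing one. *)
Definition haar_ae (P : SL -> Prop) : Prop :=
  forall mu : {measure set borelSL -> \bar R}, haar_measure mu ->
    {ae mu, forall g : borelSL, P g}.

End SpecialLinear.

Section Forms.
Context {R : realType} {n : nat}.

(* x_1^2 + ... + x_p^2 - x_(p+1)^2 - ... - x_n^2, of signature (p, n - p) *)
Definition std_form (p : nat) (v : 'rV[R]_n) : R :=
  \sum_(i < n | (i < p)%N) v 0 i ^+ 2 - \sum_(i < n | (p <= i)%N) v 0 i ^+ 2.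

(* The signature is (p1, n - p1). *)
Definition almost_all_forms (p1 : nat) (P : ('rV[R]_n -> R) -> Prop) : Prop :=
  forall lambda : R, 0 < lambda ->
    haar_ae (fun g : SL R n => P (fun v => lambda * std_form p1 (v *m g))).

Definition almost_every_indefinite_form (P : ('rV[R]_n -> R) -> Prop) : Prop :=
  forall p1 p2 : nat, (1 <= p1)%N -> (1 <= p2)%N -> (p1 + p2)%N = n ->
    almost_all_forms p1 P.

Definition shift_form (Q : 'rV[R]_n -> R) (alpha v : 'rV[R]_n) : R :=
  Q (v + alpha).

End Forms.

(* Main.v *)
Require Import Defs.
From mathcomp Require Import all_boot all_order all_algebra.
From mathcomp Require Import all_classical all_reals all_analysis.
From mathcomp Require Import measurable_realfun ring lra zify.

Set Implicit Arguments.
Unset Strict Implicit.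
Unset Printing Implicit Defensive.

Import Order.TTheory GRing.Theory Num.Theory.
Import numFieldNormedType.Exports.

Local Open Scope classical_set_scope.
Local Open Scope ring_scope.

(** The bound on [kappa] is at most 1/3, because the uniform Diophantine exponent
    is at most the ordinary one ([critical_exponent_le],
    [unif_le_dioph_exponent]). For [t] between [N ^ 3] and [(N + 1) ^ 3] it is
    therefore enough to find an integer vector of norm at most [N ^ 3] at which
    the shifted form is within [1 / (N + 1)] of [xi] ([cube_scale]). Let
    [bad_set N] consist of the matrices for which there is none. By
    Borel-Cantelli, almost every matrix lies in only finitely many of these sets
    once their measures are [O(1 / N ^ 2)] on each piece of a countable cover of
    the group ([measure_bad_piece], [bad_negligible]).

    This estimate comes from averaging over shears. A Haar measure is invariant
    under left multiplication by the shears [x |-> x + <s, x> e], where [e] is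
    the last basis vector, and the form of [h * g] at [v] is the form of [g] at
    [v h]. So the measure of the bad part of a piece is its average over any
    finite family of bounded shears, and it is bounded by the measure of a
    compact set times the largest proportion of bad shears for a fixed [g]
    ([sum_measure_le]).

    For fixed [g] the proportion is bounded by elementary means. An indefinite
    non-degenerate form takes both signs on some line of direction [e]
    ([ex_sign_change]), and hence, for each candidate [x] in a box of
    [A ^ 2 ~ N ^ 6] shifted integer points near a large multiple of a point of
    this line, the value [xi] at some [x + r e] with [r] real
    ([root_on_line]). After the shear, an integer multiple [k e] does the same up
    to [1 / (N + 1)] if [k + <s, x>] is within a constant times [N ^ (-4)] of
    [r]. The family of shears is indexed by the plane over a prime field 'F_p
    in such a way that [p <s, x>] is an integer of residue [z.1 + z.2 * m], with
    distinct keys [m] for distinct candidates. These residues are uniform and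
    pairwise independent, so by Chebyshev's inequality all candidates fail
    simultaneously only for a proportion [O(N ^ 4 / A ^ 2) = O(1 / N ^ 2)] of the
    shears ([card_hash_miss], [card_bad_shears]). *)

(** * Pairwise independent hashing over a finite field *)

(** Chebyshev's inequality. For uniform [z] in [F * F] the elements
    [z.1 + z.2 * m u - C u] are uniform and pairwise independent, because
    [z |-> (z.1 + z.2 * m u, z.1 + z.2 * m w)] is a bijection when
    [m u != m w]. The number [N z] of hits of [W] thus has mean
    [n / q = #|U| #|W| / #|F|] and variance at most its mean, while a miss
    deviates from the mean by the mean itself. *)
Lemma card_hash_miss (F : finFieldType) (U : finType) (m C : U -> F)
    (W : {set F}) : injective m ->
  (#|[set z : F * F | [forall u, (z.1 + z.2 * m u - C u)%R \notin W]]%SET|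
     * (#|U| * #|W|) <= #|F| ^ 3)%N.
Proof.
move=> m_inj.
pose hit z u : bool := z.1 + z.2 * m u - C u \in W.
pose N z : int := \sum_u (hit z u)%:R.
have [q qE] : {q : int | q = #|F|%:R} by exists #|F|%:R.
have [l lE] : {l : int | l = #|W|%:R} by exists #|W|%:R.
have [k kE] : {k : int | k = #|U|%:R} by exists #|U|%:R.
have sumW : \sum_x (x \in W)%:R = l.
  rewrite lE -sum1_card natr_sum [RHS]big_mkcond.
  by apply: eq_bigr => x _; case: (x \in W).
have sumF (c : int) : \sum_(x : F) c = q * c.
  by rewrite sumr_const -mulr_natl qE.
have sumU (c : int) : \sum_(x : U) c = k * c.
  by rewrite sumr_const -mulr_natl kE.
have hit1 u : \sum_z (hit z u)%:R = q * l.
  rewrite -(pair_bigA _ (fun x y => (hit (x, y) u)%:R)) exchange_big /=.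
  rewrite (eq_bigr (fun=> l)) => [|y _]; first exact: sumF.
  rewrite (reindex_inj (addIr (C u - y * m u))) /= -[RHS]sumW.
  apply: eq_bigr => x _; rewrite /hit /= (_ : _ - C u = x) //; ring.
have hit2 u w : u != w -> \sum_z (hit z u)%:R * (hit z w)%:R = l * l.
  move=> uw; have muw : m u - m w != 0.
    by rewrite subr_eq0; apply: contra uw => /eqP/m_inj ->.
  pose f (z : F * F) := (z.1 + z.2 * m u - C u, z.1 + z.2 * m w - C w).
  have f_inj : injective f.
    move=> [x y] [x' y'] [] /= e1 e2.
    have : (y - y') * (m u - m w) = 0.
      have -> : (y - y') * (m u - m w) = (x + y * m u - C u)
        - (x' + y' * m u - C u) - (x + y * m w - C w) + (x' + y' * m w - C w).
        by ring.
      by rewrite e1 e2; ring.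
    move=> /eqP; rewrite mulf_eq0 (negPf muw) orbF subr_eq0 => /eqP yy.
    by move: e1; rewrite yy => /addIr/addIr ->.
  rewrite -sumW big_distrlr /=.
  rewrite pair_bigA /= [RHS](reindex_inj f_inj) /=.
  by apply: eq_bigr => z _; rewrite /hit.
have sumN : \sum_z N z = k * (q * l).
  rewrite exchange_big /=; under eq_bigr => u _ do rewrite hit1.
  exact: sumU.
have sumN2 : \sum_z N z ^+ 2 <= k * (q * l) + k ^+ 2 * (l * l).
  under eq_bigr => z _ do rewrite expr2 /N big_distrlr /=.
  rewrite exchange_big /=.
  have -> : k * (q * l) + k ^+ 2 * (l * l) =
      \sum_(u : U) (q * l + \sum_(w : U) l * l).
    by rewrite big_split /= !sumU; ring.
  apply: ler_sum => u _; rewrite exchange_big /= (bigD1 u) //=.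
  apply: lerD.
    rewrite -(hit1 u); apply: ler_sum => z _.
    by case: (hit z u) => /=; rewrite ?mulr1 ?mulr0.
  have -> : \sum_(w : U) l * l = l * l + \sum_(w | w != u) l * l.
    by rewrite (bigD1 u).
  rewrite ler_wpDl ?mulr_ge0 ?lE ?ler0n // -lE.
  by apply: ler_sum => w wu; rewrite hit2 // eq_sym.
set Z := #|_|; pose n := k * l.
have key : Z%:R * n ^+ 2 <= q ^+ 3 * n.
  have -> : Z%:R * n ^+ 2 = \sum_z
      ([forall u, z.1 + z.2 * m u - C u \notin W])%:R * n ^+ 2.
    rewrite -mulr_suml; congr (_ * _); rewrite /Z -sum1_card natr_sum.
    rewrite [LHS]big_mkcond; apply: eq_bigr => z _.
    by rewrite inE; case: [forall u, _].
  have -> : q ^+ 3 * n = q ^+ 2 * (k * (q * l) + k ^+ 2 * (l * l))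
     - 2 * q * n * (k * (q * l)) + q ^+ 2 * n ^+ 2 by rewrite /n; ring.
  apply: (@le_trans _ _ (\sum_z (q * N z - n) ^+ 2)).
    apply: ler_sum => z _; case: forallP => [h|_]; last first.
      by rewrite mul0r sqr_ge0.
    rewrite (_ : N z = 0) ?mulr0 ?sub0r ?sqrrN ?mul1r //.
    by apply: big1 => u _; rewrite /hit (negPf (h u)).
  have -> : \sum_z (q * N z - n) ^+ 2 =
      q ^+ 2 * (\sum_z N z ^+ 2) - 2 * q * n * (\sum_z N z) + q ^+ 2 * n ^+ 2.
    rewrite !mulr_sumr -sumrB.
    have -> : q ^+ 2 * n ^+ 2 = \sum_(z : F * F) n ^+ 2.
      by rewrite sumr_const card_prod -[in RHS]mulr_natl natrM -qE expr2.
    by rewrite -big_split /=; apply: eq_bigr => z _; ring.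
  rewrite sumN lerD2r lerD2r; apply: ler_wpM2l => //.
  by rewrite sqr_ge0.
case: (posnP (#|U| * #|W|)) => [->|n_gt0]; first by rewrite muln0.
have n0 : 0 < n by rewrite /n kE lE -natrM ltr0n.
move: key; rewrite expr2 mulrA ler_pM2r // /n kE lE qE -!natrM -natrX.
by rewrite ler_nat.
Qed.

(** Passing from residues to real numbers: [H / p] lies within [L / p] of [c]
    modulo 1 as soon as [H - floor (p c)] has a residue in an interval of
    length [L]. *)
Lemma hash_window (R : realType) (p : nat) (L : nat) (c : R) (H : int) :
  prime p -> (0 < L)%N ->
  (H%:~R - (Num.floor (p%:R * c))%:~R : 'F_p)
    \in [set w : 'F_p | (w < L)%N]%SET ->
  exists k : int, `|k%:~R + H%:~R / p%:R - c| <= L%:R / p%:R :> R.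
Proof.
move=> p_pr L0; set C := Num.floor _; rewrite inE.
set w := (_ - _) => wL.
have w0 : ((H - C - Posz w)%:~R : 'F_p) = 0.
  by rewrite rmorphB /= rmorphB /= -/w [X in _ - X](natr_Zp w) subrr.
have : (p %| (H - C - Posz w)%R)%Z.
  by rewrite (dvdz_pcharf (pchar_Fp p_pr)) w0.
case/dvdzP => k kE; exists (- k).
have p0 : (0 < p%:R :> R) by rewrite ltr0n prime_gt0.
have HE : H%:~R = C%:~R + (w : nat)%:R + k%:~R * p%:R :> R.
  have -> : H = C + Posz w + k * Posz p by rewrite -kE; ring.
  by rewrite !rmorphD rmorphM /= -!pmulrn.
have /andP[C1] := floor_itv (p%:R * c); rewrite -/C rmorphD /= => C2.
have -> : (- k)%:~R + H%:~R / p%:R - c =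
    (C%:~R + (w : nat)%:R - p%:R * c) / p%:R.
  by rewrite HE rmorphN /=; field; rewrite gt_eqF.
rewrite normrM normfV (gtr0_norm p0) ler_pM2r ?invr_gt0 //.
have w1 : (w : nat)%:R + 1 <= L%:R :> R by rewrite natr1 ler_nat.
have w00 : 0 <= (w : nat)%:R :> R by [].
by rewrite ler_norml; apply/andP; split; lra.
Qed.

(** * Shears with parameters in a finite plane *)

Definition sup_le (R : realType) (n : nat) (X : R) (x : 'rV[R]_n) : Prop :=
  forall i, `|x 0 i| <= X.

Lemma sup_leD (R : realType) (n : nat) (X Y : R) (x y : 'rV[R]_n) :
  sup_le X x -> sup_le Y y -> sup_le (X + Y) (x + y).
Proof. by move=> hx hy i; rewrite mxE (le_trans (ler_normD _ _)) ?lerD. Qed.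

Lemma sup_leZ (R : realType) (n : nat) (X c : R) (x : 'rV[R]_n) :
  sup_le X x -> sup_le (`|c| * X) (c *: x).
Proof. by move=> hx i; rewrite mxE normrM ler_wpM2l. Qed.

Lemma sup_le_trans (R : realType) (n : nat) (X Y : R) (x : 'rV[R]_n) :
  X <= Y -> sup_le X x -> sup_le Y x.
Proof. by move=> XY hx i; exact: le_trans XY. Qed.

Lemma sup_le_delta (R : realType) (n : nat) (i : 'I_n) :
  sup_le 1 (delta_mx 0 i : 'rV[R]_n).
Proof.
by move=> j; rewrite mxE eqxx /=; case: eqP; rewrite ?normr1 ?normr0.
Qed.

Lemma sup_le_ge0 (R : realType) (n : nat) (X : R) (x : 'rV[R]_n.+1) :
  sup_le X x -> 0 <= X.
Proof. by move=> /(_ 0); apply: le_trans. Qed.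

Section ShearFunctional.
Context (R : realType) (n : nat) (i0 i1 i2 il : 'I_n).

(** The linear functional whose coefficients [s] are supported on the three
    coordinates [i0], [i1], [i2]; the shear attached to [s] moves [x] by
    [pairing s x] in the direction [il]. Of these coordinates one makes the
    hash uniform, and the other two carry the two digits of the hash key. *)
Definition pairing (s : R * R * R) (x : 'rV[R]_n) : R :=
  s.1.1 * x 0 i0 + s.1.2 * x 0 i1 + s.2 * x 0 i2.

Lemma pairing_bound (s : R * R * R) (S X : R) (x : 'rV[R]_n) :
  `|s.1.1| <= S -> `|s.1.2| <= S -> `|s.2| <= S -> sup_le X x ->
  `|pairing s x| <= 3 * S * X.
Proof.
move=> h1 h2 h3 hx.
have -> : 3 * S * X = S * X + S * X + S * X by ring.
by rewrite (le_trans (ler_normD _ _)) // lerD //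
  ?(le_trans (ler_normD _ _)) // ?lerD // normrM ler_pM.
Qed.

Lemma pairing_shift (s : R * R * R) (x : 'rV[R]_n) (r : R) :
  uniq [:: i0; i1; i2; il] ->
  pairing s (x + r *: delta_mx 0 il) = pairing s x.
Proof.
rewrite /= !inE !negb_or => /and4P[/and3P[_ _ h0] /andP[_ h1] h2 _].
by rewrite /pairing !mxE (negPf h0) (negPf h1) (negPf h2) /= !mulr0 !addr0.
Qed.

(** The first coefficient is solved for so that the real part [alpha] of the
    coordinates cancels, and [pairing s x] becomes an integer divided by [p]
    with the residue [z.1 + z.2 * key] (see [hash_coefE] and [hash_num_Fp]).
    The representative of [z.2 * A] below [p] is taken in the third
    coefficient in order to keep the shear bounded. *)
Definition hash_coef (p A : nat) (alpha : 'rV[R]_n) (x0 : R)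
    (z : 'F_p * 'F_p) : R * R * R :=
  let s1 := (z.2 : nat)%:R / p%:R in
  let s2 := ((z.2 * A%:R)%R : nat)%:R / p%:R in
  (((z.1 : nat)%:R / p%:R - s1 * alpha 0 i1 - s2 * alpha 0 i2) / x0, s1, s2).

Definition hash_num (p A : nat) (z : 'F_p * 'F_p) (y1 y2 : int) : int :=
  Posz (z.1 : nat) + Posz (z.2 : nat) * y1 + Posz ((z.2 * A%:R)%R : nat) * y2.

Lemma hash_coefE (p A : nat) (alpha : 'rV[R]_n) (z : 'F_p * 'F_p)
    (x : 'rV[R]_n) (y1 y2 : int) : prime p -> x 0 i0 != 0 ->
  x 0 i1 = alpha 0 i1 + y1%:~R -> x 0 i2 = alpha 0 i2 + y2%:~R ->
  pairing (hash_coef A alpha (x 0 i0) z) x = (hash_num A z y1 y2)%:~R / p%:R.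
Proof.
move=> p_pr x0 h1 h2; rewrite /pairing /hash_coef /= h1 h2 /hash_num.
rewrite !(rmorphD, rmorphM) /= -!pmulrn; field.
by rewrite x0 pnatr_eq0 -lt0n prime_gt0.
Qed.

Lemma hash_num_Fp (p A : nat) (z : 'F_p * 'F_p) (y1 y2 : int) :
  (hash_num A z y1 y2)%:~R = z.1 + z.2 * (y1 + Posz A * y2)%:~R :> 'F_p.
Proof.
have E (a b c : 'F_p) :
    (Posz a + Posz b * y1 + Posz c * y2)%:~R = a + b * y1%:~R + c * y2%:~R.
  have F (w : 'F_p) : (Posz w)%:~R = w := natr_Zp w.
  by rewrite !(rmorphD, rmorphM) /= !F.
rewrite /hash_num E [in RHS]rmorphD rmorphM /= mulrDr.
by rewrite -[(Posz A)%:~R]/(A%:R) mulrA addrA.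
Qed.

Lemma hash_coef_bound (p A : nat) (alpha : 'rV[R]_n) (x0 a1 : R)
    (z : 'F_p * 'F_p) : prime p -> 1 <= `|x0| -> 0 <= a1 -> sup_le a1 alpha ->
  [/\ `|(hash_coef A alpha x0 z).1.1| <= 1 + 2 * a1,
      `|(hash_coef A alpha x0 z).1.2| <= 1 + 2 * a1 &
      `|(hash_coef A alpha x0 z).2| <= 1 + 2 * a1].
Proof.
move=> p_pr x01 a10 ha.
have p0 : 0 < p%:R :> R by rewrite ltr0n prime_gt0.
have w1 (w : 'F_p) : `|(w : nat)%:R / p%:R : R| <= 1.
  rewrite ger0_norm ?divr_ge0 ?ler0n // ler_pdivrMr // mul1r ler_nat ltnW //.
  by rewrite -{2}(Fp_cast p_pr) ltn_ord.
rewrite /hash_coef; move: (z.2 * A%:R)%R => e2 /=.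
split; [|apply: (le_trans (w1 _)); lra..].
rewrite normrM normfV ler_pdivrMr ?(lt_le_trans ltr01) //.
apply: (@le_trans _ _ (1 + 2 * a1)); last by rewrite ler_peMr //; lra.
have -> : 1 + 2 * a1 = 1 + a1 + a1 by ring.
rewrite !(le_trans (ler_normB _ _)) // lerD // ?(le_trans (ler_normB _ _)) //
  ?lerD // normrM -[leRHS]mul1r ler_pM //.
Qed.

End ShearFunctional.

(** * A form with a sign change is hit by most shears *)

(** Intermediate values on the segment from 0 to [X], in a form which covers
    both signs of [X]. *)
Lemma quadratic_ivt (R : rcfType) (a b c X xi : R) :
  c <= xi -> xi <= a * X ^+ 2 + b * X + c ->
  exists2 r, `|r| <= `|X| & a * r ^+ 2 + b * r + c = xi.
Proof.
move=> h0 h1.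
pose P : {poly R} := (a * X ^+ 2) *: 'X^2 + (b * X) *: 'X + (c - xi)%:P.
have PE t : P.[t] = a * (t * X) ^+ 2 + b * (t * X) + c - xi.
  by rewrite /P !(hornerD, hornerZ, hornerXn, hornerX, hornerC); ring.
have [|t /andP[t0 t1] /rootP] := @poly_ivt R P 0 1 ler01.
  by rewrite !PE mul0r mul1r; apply/andP; split; lra.
rewrite PE => Pt; exists (t * X); last by lra.
by rewrite normrM ger0_norm // ler_piMl.
Qed.

Section Approximation.
Context (R : realType) (n : nat).
Context (q : 'rV[R]_n -> R) (B : 'rV[R]_n -> 'rV[R]_n -> R) (K : R).
Context (qD : forall x y r,
  q (x + r *: y) = q x + 2 * r * B x y + r ^+ 2 * q y).
Context (Ble : forall x y X Y, sup_le X x -> sup_le Y y ->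
  `|B x y| <= K * X * Y).
Context (qle : forall x X, sup_le X x -> `|q x| <= K * X ^+ 2).
Context (K1 : 1 <= K).

(** The cross term and the term quadratic in [w] are small against [T ^ 2],
    because [T] is a large multiple of the size of [w]. *)
Lemma perturbed_value (a w : 'rV[R]_n) (a0 T W : R) (D : nat) :
  1 <= a0 -> sup_le a0 a -> sup_le (2 * W) w -> 0 <= W ->
  T = D%:R * W -> 16 * K * (a0 + 1) <= D%:R ->
  `|q (w + T *: a) - T ^+ 2 * q a| <= T ^+ 2 / 2.
Proof.
move=> a01 ha hw W0 TE hD.
have K1' := K1; have D0 : 0 <= D%:R :> R by [].
have Ka0 : 0 <= K * a0.
  by apply: mulr_ge0; lra.
have T0 : 0 <= T by rewrite TE mulr_ge0.
rewrite qD addrK (le_trans (ler_normD _ _)) // !normrM normr_nat (ger0_norm T0).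
have h1 := qle hw; have h2 := Ble hw ha.
apply: (@le_trans _ _ (K * (2 * W) ^+ 2 + 2 * T * (K * (2 * W) * a0))).
  by rewrite lerD // ler_wpM2l // mulr_ge0.
have -> : K * (2 * W) ^+ 2 + 2 * T * (K * (2 * W) * a0) =
  W ^+ 2 * (4 * K + 4 * (K * a0) * D%:R) by rewrite TE; ring.
have -> : T ^+ 2 / 2 = W ^+ 2 * (D%:R ^+ 2 / 2) by rewrite TE; field.
apply: ler_wpM2l; first exact: sqr_ge0.
have D1 : 1 <= D%:R :> R by nra.
have : 16 * K * (a0 + 1) * D%:R <= D%:R * D%:R by rewrite ler_wpM2r.
have : K <= K * D%:R by rewrite ler_peMr //; lra.
rewrite expr2; nra.
Qed.

(** The opposite signs of [q] at [a] and [a + rho e] persist, magnified by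
    [T ^ 2], at the two ends of the translated segment, so that [q] takes the
    value [xi] on it. *)
Lemma root_on_line (a e w : 'rV[R]_n) (rho xi a0 T W : R) (D : nat) :
  1 <= a0 -> sup_le a0 a -> sup_le a0 (a + rho *: e) -> sup_le (2 * W) w ->
  0 <= W -> T = D%:R * W -> 16 * K * (a0 + 1) <= D%:R ->
  q a <= -1 -> 1 <= q (a + rho *: e) -> `|xi| <= T ^+ 2 / 2 ->
  exists2 r, `|r| <= T * `|rho| & q (w + T *: a + r *: e) = xi.
Proof.
move=> a01 ha hb hw W0 TE hD qa qb /ler_normlP[xi1 xi2].
have T0 : 0 <= T by rewrite TE mulr_ge0.
have /ler_normlP[_ h1] := perturbed_value a01 ha hw W0 TE hD.
have /ler_normlP[h2 _] := perturbed_value a01 hb hw W0 TE hD.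
have TT : 0 <= T ^+ 2 := sqr_ge0 T.
set x := w + T *: a in h1 *.
have E : w + T *: (a + rho *: e) = x + (T * rho) *: e.
  by rewrite scalerDr scalerA addrA.
rewrite E in h2.
have [||r hr <-] := @quadratic_ivt R (q e) (2 * B x e) (q x) (T * rho) xi.
- nra.
- move: h2; rewrite qD; nra.
- by exists r; [move: hr; rewrite normrM (ger0_norm T0)|rewrite qD; ring].
Qed.

Lemma near_root (y e : 'rV[R]_n) (z Y : R) :
  sup_le Y y -> sup_le 1 e -> `|z| <= 1 -> 1 <= Y ->
  `|q (y + z *: e) - q y| <= `|z| * (3 * K * Y).
Proof.
move=> hy he z1 Y1; have K1' := K1.
have h1 := Ble hy he; have h2 := qle he.
have -> : q (y + z *: e) - q y = z * (2 * B y e + z * q e) by rewrite qD; ring.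
rewrite normrM ler_wpM2l // (le_trans (ler_normD _ _)) // !normrM normr_nat.
have : `|z| * `|q e| <= 1 * (K * 1 ^+ 2) by rewrite ler_pM.
have : K <= K * Y by rewrite ler_peMr //; lra.
nra.
Qed.

(** The segment from [a] to [a + rho e] is magnified by [tau]. Candidates are
    obtained from [tau a] by adding [alpha] and one of [A ^ 2] integer vectors
    in a box, whose size [A] is the fraction [1 / D] of [tau]. The window to be
    hit by the last coordinate has length at most [1 / den], which is
    [1 / (N + 1)] divided by a bound [E * tau] for the slope of the form. *)
Context (i0 i1 i2 il : 'I_n) (i_uniq : uniq [:: i0; i1; i2; il]).
Context (alpha : 'rV[R]_n) (xi : R).
Context (a : 'rV[int]_n) (rho : int) (a0 a1 : R).
Let ra : 'rV[R]_n := map_mx intr a.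
Let e : 'rV[R]_n := delta_mx 0 il.
Context (a0_ge1 : 1 <= a0) (ra_le : sup_le a0 ra)
  (rb_le : sup_le a0 (ra + rho%:~R *: e)) (a1_ge0 : 0 <= a1)
  (alpha_le : sup_le a1 alpha).
Context (q_neg : q ra <= -1) (q_pos : 1 <= q (ra + rho%:~R *: e)).
Context (D E A N p : nat).
Context (D_large : 16 * K * (a0 + 1) <= D%:R)
  (E_large : 9 * K * (a0 + 1) < E%:R)
  (A_large : a1 + 2 <= A%:R) (A_xi : `|xi| <= A%:R).
Let tau := (D * A)%N.
Let den := (E * tau * N.+1)%N.
Context (p_pr : prime p) (p_den : (den < p)%N) (p_A : (A ^ 2 < p)%N).

(** The magnified segment and the box account for the first summand, together
    with the rounding; the displacements by the shears [z] and [z0] for the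
    second. *)
Definition solution_radius : R :=
  3 * (a0 + 1) + 6 * (1 + 2 * a1) * (a0 + 2).

(** The coordinate [i0] is fixed throughout the box, and is at least 1 in
    absolute value: one of a number and that number plus 2 always is. *)
Definition offset : int :=
  if 1 <= `|alpha 0 i0 + (tau%:Z * a 0 i0)%:~R| then 0 else 2.

Definition pivot : R := alpha 0 i0 + (tau%:Z * a 0 i0 + offset)%:~R.

Lemma pivot_ge1 : 1 <= `|pivot|.
Proof.
rewrite /pivot /offset; case: ifP => [|/negbT]; first by rewrite addr0.
rewrite -ltNge ltr_norml => /andP[h1 h2]; rewrite rmorphD /= addrA.
by rewrite ger0_norm; lra.
Qed.

Definition box_vector (u : 'I_A * 'I_A) : 'rV[int]_n :=
  \row_i (if i == i0 then offset else if i == i1 then Posz u.1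
          else if i == i2 then Posz u.2 else 0).

Lemma line_length_le : `|rho%:~R : R| <= 2 * a0.
Proof.
have := lerD (rb_le il) (ra_le il).
have := ler_normB ((ra + rho%:~R *: e) 0 il) (ra 0 il).
by rewrite !mxE !eqxx mulr1 /= addrAC subrr add0r; lra.
Qed.

Lemma box_gt0 : (0 < A)%N.
Proof. by have := A_large; rewrite -(ltr_nat R); have := a1_ge0; lra. Qed.

Lemma box_ge2 : (2 : R) <= A%:R.
Proof. by have := A_large; have := a1_ge0; lra. Qed.

Lemma ratio_ge32 : (32 : R) <= D%:R.
Proof. by have := D_large; have := K1; have := a0_ge1; nra. Qed.

Lemma scale_ge : (32 : R) * A%:R <= tau%:R.
Proof. by rewrite /tau natrM ler_wpM2r // ratio_ge32. Qed.

Lemma box_vector_le (u : 'I_A * 'I_A) :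
  sup_le A%:R (map_mx intr (box_vector u) : 'rV[R]_n).
Proof.
move=> i; rewrite !mxE; have A2 := box_ge2.
case: ifP => _.
  by rewrite /offset; case: ifP => _; rewrite ?normr0 ?ler0n ?normr_nat.
case: ifP => _; first by rewrite -pmulrn normr_nat ler_nat ltnW.
case: ifP => _; first by rewrite -pmulrn normr_nat ler_nat ltnW.
by rewrite normr0.
Qed.

Let x u : 'rV[R]_n := alpha + map_mx intr (box_vector u) + tau%:R *: ra.

Lemma candidate_le u : sup_le ((a0 + 2) * tau%:R) (x u).
Proof.
have A2 := box_ge2; have tA := scale_ge; have Aa1 := A_large.
have a01 := a0_ge1; have a10 := a1_ge0.
apply: sup_le_trans (sup_leD (sup_leD alpha_le (box_vector_le u))
  (sup_leZ tau%:R ra_le)).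
by rewrite normr_nat; nra.
Qed.

Lemma candidate_i0 u : x u 0 i0 = pivot.
Proof. by rewrite !mxE eqxx /pivot rmorphD rmorphM /= -pmulrn; ring. Qed.

Let y1 (u : 'I_A * 'I_A) : int := Posz tau * a 0 i1 + Posz u.1.
Let y2 (u : 'I_A * 'I_A) : int := Posz tau * a 0 i2 + Posz u.2.

Lemma candidate_i1 u : x u 0 i1 = alpha 0 i1 + (y1 u)%:~R.
Proof.
move: i_uniq; rewrite /= !inE !negb_or => /and4P[/and3P[h _ _] _ _ _].
by rewrite !mxE eq_sym (negPf h) eqxx /y1 rmorphD rmorphM /= -!pmulrn; ring.
Qed.

Lemma candidate_i2 u : x u 0 i2 = alpha 0 i2 + (y2 u)%:~R.
Proof.
move: i_uniq; rewrite /= !inE !negb_or => /and4P[/and3P[_ h _] /andP[h' _] _ _].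
rewrite !mxE eq_sym (negPf h) eq_sym (negPf h') eqxx /y2 rmorphD rmorphM /=.
by rewrite -!pmulrn; ring.
Qed.

(** The hash key of [u] is, up to a constant, the number with the two digits
    [u.1] and [u.2] in base [A], which is below [p]. *)
Let m (u : 'I_A * 'I_A) : 'F_p := (y1 u + Posz A * y2 u)%:~R.

Lemma hash_key_inj : injective m.
Proof.
move=> u w /eqP; rewrite -subr_eq0 /m -rmorphB /=.
rewrite -(dvdz_pcharf (pchar_Fp p_pr)).
have -> : y1 u + Posz A * y2 u - (y1 w + Posz A * y2 w) =
   (Posz (u.1 + A * u.2)%N) - Posz (w.1 + A * w.2)%N.
  by rewrite /y1 /y2 !PoszD !PoszM; ring.
have lt_p (v : 'I_A * 'I_A) : (v.1 + A * v.2 < p)%N.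
  apply: leq_trans p_A; case: v => [[v1 h1] [v2 h2]] /=; nia.
rewrite -eqz_mod_dvd !modz_nat eqz_nat !modn_small // => /eqP h.
have A0 := box_gt0.
have e1 : u.1 = w.1 :> nat.
  have := congr1 (modn^~ A) h.
  by rewrite ![(_ + A * _)%N]addnC ![(A * _)%N]mulnC !modnMDl !modn_small.
have e2 : u.2 = w.2 :> nat by move: h; rewrite e1; nia.
by case: u w {h} e1 e2 => [u1 u2] [w1 w2] /= /val_inj -> /val_inj ->.
Qed.

Definition shear_coef (z : 'F_p * 'F_p) := hash_coef i1 i2 A alpha pivot z.
Let sdot := @pairing R n i0 i1 i2.

(** For every candidate the equation [q = xi] has a real solution in the
    direction [e] (lemma [root_on_line]). The shear [z], compared with the
    reference shear [z0], moves the candidate by a hash of [z], so that an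
    integer correction lands in the window above the real solution unless the
    hash of [z] misses it. A bad [z] misses for all candidates at once, and
    [card_hash_miss] counts these. *)
Lemma card_bad_shears (z0 : 'F_p * 'F_p) (Z : {set 'F_p * 'F_p}) :
  (forall z, z \in Z -> forall v : 'rV[int]_n,
     sup_le (solution_radius * tau%:R) (map_mx intr v : 'rV[R]_n) ->
     forall y : 'rV[R]_n, y = map_mx intr v + alpha ->
     N.+1%:R^-1 <=
     `|q (y + (sdot (shear_coef z) y - sdot (shear_coef z0) y) *: e) - xi|) ->
  (#|Z| * (A ^ 2 * (p %/ den)) <= p ^ 3)%N.
Proof.
move=> bad.
have k1 := K1; have a01 := a0_ge1; have a10 := a1_ge0.
have A2 := box_ge2; have tA := scale_ge; have Aa1 := A_large.
have tau1 : 1 <= tau%:R :> R by lra.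
have A_ge0 : 0 <= A%:R :> R by [].
have tauE : tau%:R = D%:R * A%:R :> R by rewrite /tau natrM.
have w_le u : sup_le (2 * A%:R) (alpha + map_mx intr (box_vector u)).
  by apply: sup_le_trans (sup_leD alpha_le (box_vector_le u)); lra.
have xi_le : `|xi| <= tau%:R ^+ 2 / 2.
  apply: (le_trans A_xi); rewrite ler_pdivlMr // expr2.
  by apply: (@le_trans _ _ (32 * A%:R * 1)); [lra | rewrite ler_pM //; lra].
have K0 : 0 <= K by exact: le_trans ler01 K1.
have a01' : 0 <= a0 + 1 by lra.
have E_gt0 : (0 < E)%N.
  by rewrite -(ltr_nat R); apply: le_lt_trans E_large; rewrite !mulr_ge0.
have tau_gt0 : (0 < tau)%N by rewrite -(ltr0n R); lra.
have den_gt0 : (0 < den)%N by rewrite /den muln_gt0 muln_gt0 E_gt0 tau_gt0.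
have root u : {r : R | `|r| <= tau%:R * `|rho%:~R| & q (x u + r *: e) = xi}.
  apply/cid2.
  exact: (root_on_line a01 ra_le rb_le (w_le u) A_ge0 tauE D_large q_neg q_pos
    xi_le).
pose r u := s2val (root u).
have r_le u : `|r u| <= tau%:R * `|rho%:~R| := s2valP (root u).
have r_root u : q (x u + r u *: e) = xi := s2valP' (root u).
(* [c u] is the position that an integer plus the hash has to approach: the
   reference shear is already part of [q]. *)
pose c u := r u + sdot (shear_coef z0) (x u).
pose C u : 'F_p := (Num.floor (p%:R * c u))%:~R.
pose L := (p %/ den)%N.
have L_gt0 : (0 < L)%N by rewrite divn_gt0 // ltnW.
pose W := [set w : 'F_p | (w < L)%N]%SET.
have cardW : #|W| = L.
  have FpE : (Zp_trunc (pdiv p)).+2 = p := Fp_cast p_pr.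
  have L_le : (L <= (Zp_trunc (pdiv p)).+2)%N by rewrite FpE leq_div.
  have wid_inj : injective (widen_ord L_le).
    by move=> u w /(congr1 (@nat_of_ord _)) h; apply: val_inj.
  rewrite -[RHS]card_ord -(card_imset _ wid_inj).
  apply: eq_card => w; rewrite inE; apply/idP/imsetP => [wL|[j _ ->]].
    by exists (Ordinal wL) => //; apply: val_inj.
  exact: (ltn_ord j).
have card_p : #|'F_p| = p by rewrite card_Fp.
have := card_hash_miss C W hash_key_inj.
rewrite card_p cardW card_prod (card_ord A) mulnn.
apply: leq_trans; rewrite leq_mul2r; apply/orP; right.
apply/subset_leq_card/fintype.subsetP => z zZ; rewrite inE; apply/forallP => u.
apply/negP => hit.
have [k] : exists k : int,
    `|k%:~R + (hash_num A z (y1 u) (y2 u))%:~R / p%:R - c u| <= L%:R / p%:R.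
  by apply: hash_window => //; rewrite hash_num_Fp.
have pivot0 : x u 0 i0 != 0.
  by rewrite candidate_i0 -normr_gt0 (lt_le_trans ltr01) ?pivot_ge1.
rewrite -(hash_coefE A z p_pr pivot0 (candidate_i1 u) (candidate_i2 u)).
rewrite candidate_i0 -/(shear_coef z) -/(sdot _ _); set zeta := _ - c u => zeta_le.
have Lp : L%:R / p%:R <= den%:R^-1 :> R.
  have p0 : 0 < p%:R :> R by rewrite ltr0n prime_gt0.
  rewrite ler_pdivrMr // ler_pdivlMl ?ltr0n // -natrM ler_nat.
  by rewrite mulnC; exact: leq_divM.
have zeta_den := le_trans zeta_le Lp.
have den1 : 1 <= den%:R :> R by rewrite ler1n.
have zeta1 : `|zeta| <= 1.
  by apply: (le_trans zeta_den); rewrite invf_le1 // ltr0n.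
have coef_le z' : `|sdot (shear_coef z') (x u)|
    <= 3 * (1 + 2 * a1) * ((a0 + 2) * tau%:R).
  have [h1 h2 h3] := hash_coef_bound i1 i2 A z' p_pr pivot_ge1 a10 alpha_le.
  by apply: pairing_bound => //; exact: candidate_le.
have r_le2 : `|r u| <= 2 * a0 * tau%:R.
  by apply: (le_trans (r_le u)); rewrite mulrC ler_wpM2r // line_length_le.
pose v : 'rV[int]_n := Posz tau *: a + box_vector u + k *: delta_mx 0 il.
have vE : map_mx intr v + alpha = x u + k%:~R *: e :> 'rV[R]_n.
  have dE : map_mx intr (delta_mx 0 il : 'rV[int]_n) = e.
    by rewrite map_delta_mx.
  rewrite /v !map_mxD !map_mxZ dE /x /ra /= -pmulrn.
  rewrite addrAC; congr (_ + _).
  by rewrite addrC (addrC (_ *: _)) addrA.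
have sumE : x u + k%:~R *: e + (sdot (shear_coef z) (x u + k%:~R *: e) -
    sdot (shear_coef z0) (x u + k%:~R *: e)) *: e = x u + r u *: e + zeta *: e.
  rewrite /sdot !(pairing_shift _ _ _ i_uniq).
  rewrite -[LHS]addrA -scalerDl -[RHS]addrA -scalerDl; congr (_ + _).
  by congr (_ *: _); rewrite /zeta /c /sdot; ring.
have v_le : sup_le (solution_radius * tau%:R) (map_mx intr v : 'rV[R]_n).
  have k_le : `|k%:~R : R| <= 1 + 2 * a0 * tau%:R +
      2 * (3 * (1 + 2 * a1) * ((a0 + 2) * tau%:R)).
    have -> : k%:~R = zeta + r u - sdot (shear_coef z) (x u)
        + sdot (shear_coef z0) (x u) :> R by rewrite /zeta /c; ring.
    have := coef_le z; have := coef_le z0; have := r_le2; have := zeta1.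
    have := ler_normD (zeta + r u - sdot (shear_coef z) (x u))
      (sdot (shear_coef z0) (x u)).
    have := ler_normB (zeta + r u) (sdot (shear_coef z) (x u)).
    have := ler_normD zeta (r u); lra.
  have -> : map_mx intr v =
      tau%:R *: ra + map_mx intr (box_vector u) + k%:~R *: e.
    move: vE; rewrite /x => /(congr1 (fun w => w - alpha)); rewrite addrK => ->.
    by apply/rowP => i; rewrite !mxE; ring.
  apply: sup_le_trans (sup_leD
    (sup_leD (sup_leZ tau%:R ra_le) (box_vector_le u))
    (sup_leZ k%:~R (@sup_le_delta R n il))).
  rewrite normr_nat mulr1 /solution_radius; lra.
have := bad z zZ v v_le _ (esym vE); rewrite sumE; apply/negP.
rewrite -ltNge -{1}(r_root u).
have y_le : sup_le (3 * (a0 + 1) * tau%:R) (x u + r u *: e).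
  apply: sup_le_trans (sup_leD (candidate_le u)
    (sup_leZ (r u) (@sup_le_delta R n il))).
  by rewrite mulr1; nra.
apply: le_lt_trans (near_root y_le (@sup_le_delta R n il) zeta1 _) _.
  by nra.
have -> : N.+1%:R^-1 = E%:R * tau%:R / den%:R :> R.
  have -> : den%:R = E%:R * tau%:R * N.+1%:R :> R by rewrite /den natrM natrM.
  by rewrite invfM mulrA divff ?mul1r // mulf_neq0 // pnatr_eq0 -lt0n.
apply: (@le_lt_trans _ _ (den%:R^-1 * (9 * K * (a0 + 1) * tau%:R))).
  have -> : 3 * K * (3 * (a0 + 1) * tau%:R) = 9 * K * (a0 + 1) * tau%:R by ring.
  by rewrite ler_wpM2r // !mulr_ge0 //; lra.
by rewrite mulrC ltr_pM2r ?invr_gt0 ?ltr0n // ltr_pM2r //; lra.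
Qed.

End Approximation.

(** * The forms and the shears as matrices *)

Section Polar.
Context (R : realType) (n p : nat) (lambda : R).

Definition form_of (g : 'M[R]_n.+1) (v : 'rV[R]_n.+1) : R :=
  lambda * std_form p (v *m g).

(** The symmetric bilinear form with [form_of g x = polar_of g x x]. *)
Definition polar_of (g : 'M[R]_n.+1) (x y : 'rV[R]_n.+1) : R :=
  lambda * (\sum_(i < n.+1 | (i < p)%N) (x *m g) 0 i * (y *m g) 0 i
    - \sum_(i < n.+1 | (p <= i)%N) (x *m g) 0 i * (y *m g) 0 i).

Lemma form_ofD g x y r : form_of g (x + r *: y) =
  form_of g x + 2 * r * polar_of g x y + r ^+ 2 * form_of g y.
Proof.
have E (P : pred 'I_n.+1) : \sum_(i < n.+1 | P i) ((x + r *: y) *m g) 0 i ^+ 2 =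
   \sum_(i < n.+1 | P i) (x *m g) 0 i ^+ 2
   + 2 * r * (\sum_(i < n.+1 | P i) (x *m g) 0 i * (y *m g) 0 i)
   + r ^+ 2 * \sum_(i < n.+1 | P i) (y *m g) 0 i ^+ 2.
  rewrite !mulr_sumr -!big_split /=; apply: eq_bigr => i _.
  rewrite mulmxDl -scalemxAl; move: (x *m g) (y *m g) => u w.
  by rewrite !mxE; ring.
by rewrite /form_of /polar_of /std_form !E; ring.
Qed.

Lemma form_of_polar g x : form_of g x = polar_of g x x.
Proof. by []. Qed.

(** A bound for the bilinear form with respect to the supremum norm when the
    entries of [g] are at most [M]; the summand 1 makes it at least 1. *)
Definition form_bound (M : R) : R :=
  `|lambda| * (n.+1%:R * (n.+1%:R * M) ^+ 2) + 1.

Lemma mulmx_bound (g : 'M[R]_n.+1) (M X : R) x j :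
  (forall i j, `|g i j| <= M) ->
  sup_le X x -> `|(x *m g) 0 j| <= n.+1%:R * M * X.
Proof.
move=> hg hx; rewrite mxE (le_trans (ler_norm_sum _ _ _)) //.
have -> : n.+1%:R * M * X = \sum_(i < n.+1) X * M.
  by rewrite sumr_const card_ord -mulr_natl; ring.
by apply: ler_sum => i _; rewrite normrM ler_pM.
Qed.

Lemma polar_of_bound (g : 'M[R]_n.+1) (M X Y : R) x y :
  (forall i j, `|g i j| <= M) -> sup_le X x -> sup_le Y y ->
  `|polar_of g x y| <= form_bound M * X * Y.
Proof.
move=> hg hx hy; rewrite /polar_of normrM.
have X0 := sup_le_ge0 hx; have Y0 := sup_le_ge0 hy.
rewrite /form_bound mulrDl mulrDl mul1r ler_wpDr ?mulr_ge0 //.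
rewrite -!mulrA ler_wpM2l // (le_trans (ler_normB _ _)) //.
apply: (@le_trans _ _ (\sum_i `|(x *m g) 0 i * (y *m g) 0 i|)).
  rewrite [leRHS](bigID (fun i : 'I_n.+1 => (i < p)%N)) /=.
  rewrite lerD ?(le_trans (ler_norm_sum _ _ _)) //.
  by under [leRHS]eq_bigl => i do rewrite -leqNgt.
rewrite [leRHS](_ : _ =
    \sum_(i < n.+1) (n.+1%:R * M * X) * (n.+1%:R * M * Y)); last first.
  by rewrite sumr_const card_ord -mulr_natl; ring.
by apply: ler_sum => i _; rewrite normrM ler_pM // mulmx_bound.
Qed.

Lemma form_of_bound (g : 'M[R]_n.+1) (M X : R) x :
  (forall i j, `|g i j| <= M) -> sup_le X x ->
  `|form_of g x| <= form_bound M * X ^+ 2.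
Proof. by move=> hg hx; rewrite form_of_polar expr2 mulrA polar_of_bound. Qed.

Lemma form_bound_ge1 M : 1 <= form_bound M.
Proof. by rewrite /form_bound lerDr mulr_ge0 // mulr_ge0 // sqr_ge0. Qed.

End Polar.

Section Shear.
Context (R : realType) (n : nat) (i0 i1 i2 : 'I_n.+1).
Context (i_uniq : uniq [:: i0; i1; i2; ord_max]).
Let e : 'rV[R]_n.+1 := delta_mx 0 ord_max.

Definition shear_mx (s : R * R * R) : 'M[R]_n.+1 :=
  1%:M + \col_i (s.1.1 * (i == i0)%:R + s.1.2 * (i == i1)%:R
                  + s.2 * (i == i2)%:R) *m e.

Lemma mul_shear s x : x *m shear_mx s = x + pairing i0 i1 i2 s x *: e.
Proof.
rewrite mulmxDr mulmx1 mulmxA; congr (_ + _).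
rewrite [_ *m \col_i _]mx11_scalar mul_scalar_mx; congr (_ *: _).
rewrite mxE; under eq_bigr => i _ do rewrite mxE !mulrDr.
rewrite !big_split /= /pairing.
have E c j : \sum_i x 0 i * (c * (i == j)%:R) = c * x 0 j.
  rewrite (bigD1 j) //= eqxx mulr1 mulrC big1 ?addr0 // => i /negPf ->.
  by rewrite !mulr0.
by rewrite !E.
Qed.

(** The shear is upper unitriangular, because its direction is the last
    coordinate. *)
Lemma det_shear s : \det (shear_mx s) == 1.
Proof.
rewrite -det_tr det_trig; last first.
  apply/is_trig_mxP => i j ij; rewrite !mxE big_ord1 !mxE.
  have -> : (j == i) = false by apply/eqP => ji; rewrite ji ltnn in ij.
  have -> : (i == ord_max) = false.
    by apply/eqP => im; move: ij; rewrite im ltnNge -ltnS ltn_ord.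
  by rewrite andbF mulr0 addr0.
rewrite big1 // => i _; rewrite !mxE big_ord1 !mxE !eqxx /=.
case: (eqVneq i ord_max) => [->|_]; last by rewrite mulr0 addr0.
move: i_uniq; rewrite /= !inE !negb_or.
move=> /and4P[/and3P[_ _ h0] /andP[_ h1] h2 _].
rewrite ![ord_max == _]eq_sym (negPf h0) (negPf h1) (negPf h2).
by rewrite !mulr0 !addr0 mul0r addr0.
Qed.

Definition shear (s : R * R * R) : SL R n.+1 := MkSL (det_shear s).

Lemma entry_mulmx (g : 'M[R]_n.+1) i j :
  g i j = ((delta_mx 0 i : 'rV_n.+1) *m g) 0 j.
Proof. by rewrite -rowE mxE. Qed.

(** The last row of a matrix is left in place by the shear, and the other rows
    change by multiples of it. *)
Lemma unshear_bound s (g : 'M[R]_n.+1) M S :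
  `|s.1.1| <= S -> `|s.1.2| <= S -> `|s.2| <= S ->
  (forall i j, `|(shear_mx s *m g) i j| <= M) ->
  forall i j, `|g i j| <= (1 + 3 * S) * M.
Proof.
move=> h1 h2 h3 hg i j.
have -> : g i j = ((delta_mx 0 i : 'rV_n.+1) *m (shear_mx s *m g)) 0 j
  - pairing i0 i1 i2 s (delta_mx 0 i) * (shear_mx s *m g) ord_max j.
  have E : e *m shear_mx s = e.
    rewrite mul_shear -[X in pairing _ _ _ _ X]add0r -[X in 0 + X]scale1r.
    rewrite (pairing_shift _ _ _ i_uniq) /pairing !mxE !mulr0 !addr0.
    by rewrite scale0r addr0.
  rewrite (entry_mulmx (_ *m g) ord_max) !mulmxA E mul_shear.
  rewrite mulmxDl -scalemxAl (entry_mulmx g i j) /e.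
  move: (_ *m g) (_ *m g) => u w; rewrite !mxE; ring.
have := pairing_bound i0 i1 i2 h1 h2 h3 (@sup_le_delta R n.+1 i).
rewrite -entry_mulmx mulr1 => hp.
by rewrite (le_trans (ler_normB _ _)) // [leRHS]mulrDl mul1r lerD // normrM
  ler_pM.
Qed.
End Shear.

(** * Bounded parts of the group and averaging of Haar measure *)

Lemma measurable_entry (R : realType) (n : nat) (i j : 'I_n) :
  measurable_fun setT (fun g : borelSL R n => SLval g i j).
Proof.
apply: (measurability _ (RGenOpens.measurableE R)) => _ [_ [a [b ->]] <-].
rewrite setTI; apply: sub_sigma_algebra; rewrite /=.
exists ((fun M : 'M[R]_n => M i j) @^-1` `]a, b[) => //.
by apply: open_comp => [M _|]; [exact: coord_continuous|exact: interval_open].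
Qed.

Lemma vec_mx_continuous (R : realType) (m n : nat) :
  continuous (vec_mx : 'rV[R]_(m * n) -> 'M[R]_(m, n)).
Proof.
move=> r B /nbhs_ballP[e /= e0 eB]; apply/nbhs_ballP; exists e => // s [_ rs].
by apply: eB; split => // i j; rewrite !mxE; exact: rs.
Qed.

(** The entries range over a compact box, in which the equation [\det = 1]
    defines a closed set. The group carries the initial topology, so that a
    cluster point of the vectors of entries gives one of the matrices. *)
Lemma compact_bounded_SL (R : realType) (n : nat) (M : R) :
  compact [set g : SL R n | forall i j, `|SLval g i j| <= M].
Proof.
pose box : set 'rV[R]_(n * n) := [set r | forall k, r 0 k \in `[- M, M]].
have box_compact : compact box.
  apply: (@rV_compact _ _ (fun=> `[- M, M]%classic)) => k.
  exact: segment_compact.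
pose d (r : 'rV[R]_(n * n)) : R := \det (vec_mx r).
have d_cont : continuous d.
  have prod_cont (s : 'I_n -> 'I_n) :
      continuous (fun r : 'rV[R]_(n * n) => \prod_i vec_mx r i (s i)).
    apply: continuous_big => [|i _]; first exact: mul_continuous.
    by under eq_fun do rewrite mxE; exact: coord_continuous.
  rewrite /d /determinant; apply: continuous_big => [|s _].
    exact: add_continuous.
  move=> r; apply: (cvgM (cvg_cst _)); do ?exact: nbhs_filter.
  exact: prod_cont.
have C_compact : compact (box `&` d @^-1` [set 1]).
  apply: (subclosed_compact _ box_compact); last by move=> r [].
  apply: closedI.
    exact: (compact_closed (@norm_hausdorff _ _) box_compact).
  by apply: preimage_closed => [r _|]; [exact: d_cont|exact: closed_eq].
move=> F FF FA.
pose vec (g : SL R n) : 'rV[R]_(n * n) := mxvec (SLval g).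
have FC : F (vec @^-1` (box `&` d @^-1` [set 1])).
  apply: filterS FA => g gM; split => [k|]; last first.
    by rewrite /= /d /vec mxvecK; exact/eqP/SL_det.
  by case/mxvec_indexP: k => i j; rewrite mxvecE in_itv /= -ler_norml.
have [r [[r_box dr] r_cluster]] := C_compact _ (fmap_proper_filter vec FF) FC.
have dr1 : \det (vec_mx r : 'M[R]_n) == 1 by apply/eqP.
exists (MkSL dr1); split.
  move=> i j /=; rewrite mxE ler_norml.
  by move: (r_box (mxvec_index i j)); rewrite in_itv.
move=> A B FA2 [_ [[U Uo <-] /= Ur UB]].
have FA3 : F (vec @^-1` (vec @` A)) by apply: filterS FA2 => g Ag; exists g.
have nU : nbhs r (vec_mx @^-1` U).
  by apply: vec_mx_continuous; apply: open_nbhs_nbhs.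
have [_ [[h Ah <-]]] := r_cluster _ _ FA3 nU.
by rewrite /vec /= mxvecK => Uh; exists h; split=> //; apply: UB.
Qed.

(** Double counting: integrate over [K] the number of [i] such that [x] lies
    in [A i]. *)
Lemma sum_measure_le d (T : measurableType d) (R : realType)
    (mu : {measure set T -> \bar R}) (I : finType) (A : I -> set T) (K : set T)
    (c : nat) : measurable K -> (forall i, measurable (A i)) ->
  (forall i, A i `<=` K) ->
  (forall x, (#|[set i | `[< A i x >]]%SET| <= c)%N) ->
  (\sum_i mu (A i) <= c%:R%:E * mu K)%E.
Proof.
move=> mK mA AK hc.
have -> : (\sum_i mu (A i) = \int[mu]_(x in K) (\sum_i (\1_(A i) x)%:E))%E.
  rewrite ge0_integral_sum // => [|i].
    by apply: eq_bigr => i _; rewrite integral_indic // setIidl.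
  by apply/measurable_EFinP; apply: measurable_funTS; exact: measurable_indic.
rewrite -integral_cst //; apply: ge0_le_integral => //.
- by move=> x _; apply: sume_ge0 => i _; rewrite lee_fin.
- apply: emeasurable_sum => i.
  by apply/measurable_EFinP; apply: measurable_funTS; exact: measurable_indic.
- move=> x _; rewrite sumEFin lee_fin.
  apply: le_trans (_ : #|[set i | `[< A i x >]]%SET|%:R <= _).
    rewrite -sum1_card natr_sum [leRHS]big_mkcond ler_sum // => i _.
    rewrite inE indicE.
    by case: asboolP => h; [rewrite mem_set|rewrite memNset].
  by rewrite ler_nat.
Qed.

Lemma haar_translate (R : realType) (n : nat)
    (mu : {measure set (borelSL R n) -> \bar R}) (h : SL R n)
    (D : set (borelSL R n)) : haar_measure mu ->
  measurable ([set x | D (h * x)%g] : set (borelSL R n)) ->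
  mu [set x | D (h * x)%g] = mu D.
Proof.
move=> [inv _ _] mD; rewrite -(inv h _ mD); congr (mu _).
apply/seteqP; split => [y /= [x Dx <-] //|y Dy] /=.
by exists (h^-1 * y)%g => /=; rewrite mulgA mulgV mul1g.
Qed.

Section Measurability.
Context (R : realType) (n p : nat) (lambda : R).

Lemma measurable_row_mul (x : 'rV[R]_n.+1) j :
  measurable_fun setT (fun g : borelSL R n.+1 => (x *m SLval g) 0 j).
Proof.
under eq_fun do rewrite mxE; apply: measurable_sum => i.
by apply: measurable_funM => //; exact: measurable_entry.
Qed.

Lemma measurable_form (x : 'rV[R]_n.+1) :
  measurable_fun setT (fun g : borelSL R n.+1 => form_of p lambda (SLval g) x).
Proof.
rewrite /form_of /std_form; apply: measurable_funM => //.
have sq (P : pred 'I_n.+1) : measurable_fun setT (fun g : borelSL R n.+1 =>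
    \sum_(i < n.+1 | P i) (x *m SLval g) 0 i ^+ 2).
  under eq_fun do rewrite -big_filter; apply: measurable_sum => i.
  by apply: measurable_funX; exact: measurable_row_mul.
by apply: measurable_funB; exact: sq.
Qed.

Lemma form_of_mul (g h : 'M[R]_n.+1) x :
  form_of p lambda (h *m g) x = form_of p lambda g (x *m h).
Proof. by rewrite /form_of mulmxA. Qed.

Lemma measurable_form_mul (h : SL R n.+1) x : measurable_fun setT
  (fun g : borelSL R n.+1 => form_of p lambda (SLval (h * g)%g) x).
Proof.
by under eq_fun do rewrite /= form_of_mul; exact: measurable_form.
Qed.

Lemma measurable_entry_mul (h : SL R n.+1) i j : measurable_fun setT
  (fun g : borelSL R n.+1 => SLval (h * g)%g i j).
Proof.
by under eq_fun do rewrite /= entry_mulmx mulmxA; exact: measurable_row_mul.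
Qed.

Lemma measurable_le_set d (T : measurableType d) (f g : T -> R) :
  measurable_fun setT f -> measurable_fun setT g ->
  measurable [set x | f x <= g x].
Proof.
by move=> mf mg; rewrite -[X in measurable X]setTI; exact: measurable_fun_le.
Qed.

Context (alpha : 'rV[R]_n.+1) (xi : R).

(** The matrices whose form has no solution at scale [N]: norm at most [N ^ 3]
    and precision [1 / (N + 1)]. *)
Definition bad_set (N : nat) : set (borelSL R n.+1) :=
  [set g | forall v : 'rV[int]_n.+1,
    l2norm (of_int v : 'rV[R]_n.+1) <= N%:R ^+ 3 ->
    N.+1%:R^-1 <= `|form_of p lambda (SLval g) (of_int v + alpha) - xi|].

Definition bounded_entries (M : R) : set (borelSL R n.+1) :=
  [set g | forall i j, `|SLval g i j| <= M].

(** On a piece the entries and the sign change of the form are controlled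
    uniformly. *)
Definition piece (M : R) (a b : 'rV[int]_n.+1) : set (borelSL R n.+1) :=
  bounded_entries M `&` [set g | form_of p lambda (SLval g) (of_int a) <= -1 /\
    1 <= form_of p lambda (SLval g) (of_int b)].

(** The measurability of sets is stated for preimages under left
    multiplication, which is what invariance of the measure asks for; [h = 1]
    gives the sets themselves. *)
Lemma bad_set_measurable N (h : SL R n.+1) :
  measurable ([set g | bad_set N (h * g)%g] : set (borelSL R n.+1)).
Proof.
rewrite (_ : [set _ | _] = ~` \bigcup_(v in [set: 'rV[int]_n.+1])
   [set g : borelSL R n.+1 | l2norm (of_int v : 'rV[R]_n.+1) <= N%:R ^+ 3 /\
    ~ (N.+1%:R^-1 <=
       `|form_of p lambda (SLval (h * g)%g) (of_int v + alpha) - xi|)]).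
  apply: measurableC; apply: countable_bigcupT_measurable => [|v].
    exact: countableP.
  have [lv|lv] := pselect (l2norm (of_int v : 'rV[R]_n.+1) <= N%:R ^+ 3);
    last first.
    by rewrite [X in measurable X](_ : _ = set0) // -subset0 => g [].
  rewrite [X in measurable X](_ : _ = ~` [set g : borelSL R n.+1 | N.+1%:R^-1 <=
    `|form_of p lambda (SLval (h * g)%g) (of_int v + alpha) - xi|]); last first.
    by apply/seteqP; split => g //= [].
  apply: measurableC; apply: measurable_le_set => //.
  apply: measurableT_comp => //; apply: measurable_funB => //.
  exact: measurable_form_mul.
apply/seteqP; split => [g gbad [v _ [lv]]|g gbad v lv].
  by apply; exact: gbad.
by apply: contrapT => nv; apply: gbad; exists v.
Qed.

Lemma bounded_entries_measurable M (h : SL R n.+1) :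
  measurable ([set g | bounded_entries M (h * g)%g] : set (borelSL R n.+1)).
Proof.
rewrite (_ : [set _ | _] = \bigcap_(i in [set: 'I_n.+1])
    \bigcap_(j in [set: 'I_n.+1])
    [set g : borelSL R n.+1 | `|SLval (h * g)%g i j| <= M]); last first.
  by apply/seteqP; split => [g hg i _ j _|g hg i j]; exact: hg.
apply: fin_bigcap_measurable => // i _; apply: fin_bigcap_measurable => // j _.
apply: measurable_le_set => //; apply: measurableT_comp => //.
exact: measurable_entry_mul.
Qed.

Lemma piece_measurable M a b (h : SL R n.+1) :
  measurable ([set g | piece M a b (h * g)%g] : set (borelSL R n.+1)).
Proof.
apply: (measurableI _ _ (bounded_entries_measurable M h)).
apply: measurableI; apply: measurable_le_set => //; exact: measurable_form_mul.
Qed.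

End Measurability.

(** * The measure of the bad set at one scale *)

Lemma ex_nat_gt (R : archiRealDomainType) (x : R) : exists k : nat, x < k%:R.
Proof.
by exists (Num.bound `|x|); rewrite (le_lt_trans (ler_norm x)) ?archi_boundP.
Qed.

Lemma ex_sup_le (R : realType) (n : nat) (x : 'rV[R]_n) :
  exists2 X, 0 <= X & sup_le X x.
Proof.
exists (\sum_i `|x 0 i|) => [|i]; first exact: sumr_ge0.
by rewrite (bigD1 i) //= lerDl sumr_ge0.
Qed.

Lemma l2norm_sup_le (R : realType) (n : nat) (X : R) (x : 'rV[R]_n.+1) :
  sup_le X x -> l2norm x <= n.+1%:R * X.
Proof.
move=> hx; have X0 := sup_le_ge0 hx.
rewrite /l2norm -[leRHS]ger0_norm ?mulr_ge0 // -sqrtr_sqr ler_wsqrtr //.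
apply: (@le_trans _ _ (\sum_(i < n.+1) X ^+ 2)).
  by apply: ler_sum => i _; rewrite -real_normK ?num_real // lerXn2r ?nnegrE.
rewrite sumr_const card_ord -[leLHS]mulr_natl exprMn ler_wpM2r ?sqr_ge0 //.
by rewrite -natrX ler_nat leq_pmull.
Qed.

(** The arithmetic of the final estimate: a proportion of about
    [den / A ^ 2 ~ N ^ 4 / N ^ 6] of the shears is bad. *)
Lemma miss_count_bound (q D E A N G : nat) :
  let den := (E * (D * A) * N.+1)%N in let L := (q %/ den)%N in
  (0 < A)%N -> (0 < N)%N -> (0 < den)%N -> (0 < L)%N -> (0 < G)%N ->
  A = (N ^ 3 %/ G)%N ->
  ((q ^ 3 %/ (A ^ 2 * L)) * N ^ 2 <= 8 * G * E * D * q ^ 2)%N.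
Proof.
move=> den L A_gt0 N_gt0 den_gt0 L_gt0 G_gt0 AE.
have q_lt : (q < L.+1 * den)%N := ltn_ceil q den_gt0.
have N_lt : (N ^ 3 < A.+1 * G)%N by rewrite AE ltn_ceil.
have c_le := leq_divM (q ^ 3) (A ^ 2 * L).
set c := (_ %/ _)%N in c_le *.
have q_le : (q <= 2 * L * den)%N.
  apply: leq_trans (ltnW q_lt) _; apply: leq_mul => //.
  exact: ltn_Pmull.
have N_le : (N ^ 3 <= 2 * G * A)%N.
  rewrite mulnAC; apply: leq_trans (ltnW N_lt) _; apply: leq_mul => //.
  exact: ltn_Pmull.
have cL : (c * A ^ 2 * L <= 2 * den * q ^ 2 * L)%N.
  rewrite -mulnA; apply: leq_trans c_le _; rewrite expnS.
  by rewrite mulnAC leq_mul2r mulnAC q_le orbT.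
have cA : (c * A * A <= 2 * (E * D * N.+1) * q ^ 2 * A)%N.
  move: cL; rewrite leq_pmul2r // expnS expn1 mulnA => /leq_trans; apply.
  by apply/eq_leq; rewrite /den; ring.
have cA' : (c * A <= 4 * (E * D * N) * q ^ 2)%N.
  move: cA; rewrite leq_pmul2r // => cA; apply: leq_trans cA _.
  rewrite leq_mul2r; apply/orP; right.
  have -> : (4 * (E * D * N) = 2 * (E * D * (N + N)))%N by ring.
  by do 2![apply: leq_mul => //]; rewrite addnn -mul2n ltn_Pmull.
rewrite -(leq_pmul2r N_gt0).
apply: (@leq_trans (c * (2 * G * A))).
  by rewrite -mulnA -expnSr leq_mul2l N_le orbT.
apply: (@leq_trans (2 * G * (4 * (E * D * N) * q ^ 2))).
  by rewrite mulnCA leq_mul2l cA' orbT.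
by apply/eq_leq; ring.
Qed.

Section Averaging.
Context (R : realType) (n p : nat) (lambda : R) (alpha : 'rV[R]_n.+4) (xi : R).
Let i0 : 'I_n.+4 := inord 0.
Let i1 : 'I_n.+4 := inord 1.
Let i2 : 'I_n.+4 := inord 2.
Let e : 'rV[R]_n.+4 := delta_mx 0 ord_max.

Lemma shear_indices : uniq [:: i0; i1; i2; ord_max].
Proof. by rewrite /= !inE -!(inj_eq val_inj) /= !inordK. Qed.

Definition line_point (a : 'rV[int]_n.+4) (rho : int) : 'rV[int]_n.+4 :=
  a + rho *: delta_mx 0 ord_max.

Lemma of_int_line_point a rho :
  of_int (line_point a rho) = of_int a + rho%:~R *: e.
Proof. by rewrite /of_int map_mxD map_mxZ map_delta_mx. Qed.

Lemma form_shear (g : SL R n.+4) s x :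
  form_of p lambda (SLval (shear shear_indices s * g)%g) x =
  form_of p lambda (SLval g) (x + pairing i0 i1 i2 s x *: e).
Proof. by rewrite /= form_of_mul mul_shear. Qed.

(** Shears in a common direction compose by adding their coefficients, so the
    form of one shear of [g] is obtained from that of another. *)
Lemma form_shear_change (g : SL R n.+4) s s0 x :
  form_of p lambda (SLval (shear shear_indices s * g)%g) x =
  form_of p lambda (SLval (shear shear_indices s0 * g)%g)
    (x + (pairing i0 i1 i2 s x - pairing i0 i1 i2 s0 x) *: e).
Proof.
rewrite !form_shear (pairing_shift _ _ _ shear_indices) -addrA -scalerDl.
by rewrite subrK.
Qed.

(** The measure is invariant under the finitely many shears [h z], so the
    measure of the bad part [X] of a piece is the average of the measures of the
    sets of [g] such that [h z * g] is in [X]. These lie in one compact set, and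
    each [g] belongs to few of them: a member [z0] provides a form
    [h z0 * g] in the piece to which [card_bad_shears] applies. *)
Lemma measure_bad_piece (mu : {measure set (borelSL R n.+4) -> \bar R})
    (M : R) (a : 'rV[int]_n.+4) (rho : int) : haar_measure mu ->
  exists (C : R) (N0 : nat), 0 <= C /\ forall N, (N0 <= N)%N ->
    (mu (bad_set p lambda alpha xi N `&` piece p lambda M a (line_point a rho))
      <= (C / N%:R ^+ 2)%:E)%E.
Proof.
move=> haar; have [_ haar_fin _] := haar.
set K := form_bound n.+3 lambda M.
have K1 : 1 <= K := form_bound_ge1 _ _ _.
have [a1 a1_ge0 alpha_le] := ex_sup_le alpha.
have [Xa Xa0 ha] := ex_sup_le (of_int a : 'rV[R]_n.+4).
have [Xb Xb0 hb] := ex_sup_le (of_int a + rho%:~R *: e : 'rV[R]_n.+4).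
pose a0 := 1 + Xa + Xb.
have a0_ge1 : 1 <= a0 by rewrite /a0; lra.
have ra_le : sup_le a0 (of_int a) by apply: sup_le_trans ha; rewrite /a0; lra.
have rb_le : sup_le a0 (of_int a + rho%:~R *: e).
  by apply: sup_le_trans hb; rewrite /a0; lra.
have [D /ltW D_large] := ex_nat_gt (16 * K * (a0 + 1)).
have [E E_large] := ex_nat_gt (9 * K * (a0 + 1)).
have [F /ltW F_large] := ex_nat_gt (solution_radius a0 a1).
have [A0 /ltW A0_large] := ex_nat_gt (a1 + 2 + `|xi|).
have D_gt0 : (0 < D)%N by rewrite -(ltr0n R); nra.
have F_gt0 : (0 < F)%N.
  rewrite -(ltr0n R); apply: lt_le_trans F_large.
  by rewrite /solution_radius; nra.
pose G := (n.+4 * F * D)%N.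
have G_gt0 : (0 < G)%N by rewrite /G !muln_gt0 F_gt0 D_gt0.
pose S := 1 + 2 * a1.
pose K' := bounded_entries ((1 + 3 * S) * M) : set (borelSL R n.+4).
have mK' : measurable K'.
  have := bounded_entries_measurable ((1 + 3 * S) * M) (1%g : SL R n.+4).
  by congr measurable; apply/seteqP; split => g; rewrite /= mul1g.
have K'_fin : (mu K' < +oo)%E by apply: haar_fin; exact: compact_bounded_SL.
pose kap := fine (mu K').
have kapE : mu K' = kap%:E by rewrite fineK // ge0_fin_numE.
have kap_ge0 : 0 <= kap by rewrite fine_ge0.
exists ((8 * G * E * D)%N%:R * kap), (G * A0).+1; split.
  by rewrite mulr_ge0.
move=> N N_large.
pose A := (N ^ 3 %/ G)%N.
have N_gt0 : (0 < N)%N := leq_trans (ltn0Sn _) N_large.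
have A_ge : (A0 <= A)%N.
  rewrite /A leq_divRL // mulnC (leq_trans (ltnW N_large)) //.
  by rewrite expnS leq_pmulr // expn_gt0 N_gt0.
have A_geR : a1 + 2 + `|xi| <= A%:R.
  by apply: le_trans A0_large _; rewrite ler_nat.
have A_large : a1 + 2 <= A%:R by have := normr_ge0 xi; lra.
have A_xi : `|xi| <= A%:R by lra.
have A_gt0 : (0 < A)%N by rewrite -(ltr0n R); lra.
pose den := (E * (D * A) * N.+1)%N.
have [q q_large q_pr] := prime_above (den + A ^ 2).
have q_den : (den < q)%N := leq_ltn_trans (leq_addr _ _) q_large.
have q_A : (A ^ 2 < q)%N := leq_ltn_trans (leq_addl _ _) q_large.
pose L := (q %/ den)%N.
pose s (z : 'F_q * 'F_q) : R * R * R := shear_coef i0 i1 i2 alpha a D A z.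
pose h (z : 'F_q * 'F_q) := shear shear_indices (s z).
pose X := bad_set p lambda alpha xi N `&` piece p lambda M a (line_point a rho).
pose c := (q ^ 3 %/ (A ^ 2 * L))%N.
have mX (k : SL R n.+4) :
    measurable ([set g | X (k * g)%g] : set (borelSL R n.+4)).
  exact: (measurableI _ _ (bad_set_measurable _ _ _ _ _ _)
    (piece_measurable _ _ _ _ _ _)).
have E_gt0 : (0 < E)%N.
  by rewrite -(ltr0n R); apply: le_lt_trans E_large; rewrite !mulr_ge0 //; lra.
have den_gt0 : (0 < den)%N by rewrite /den !muln_gt0 E_gt0 D_gt0 A_gt0.
have L_gt0 : (0 < L)%N by rewrite divn_gt0 // ltnW.
have mult (g : borelSL R n.+4) : (#|[set z | `[< X (h z * g)%g >]]%SET| <= c)%N.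
  rewrite leq_divRL ?muln_gt0 ?expn_gt0 ?A_gt0 //.
  set Z := [set _ | _]%SET.
  have [->|[z0]] := set_0Vmem Z; first by rewrite cards0.
  rewrite inE => /asboolP[_ [g0M [qa qb]]].
  move: qb; rewrite of_int_line_point => qb.
  apply: (card_bad_shears (form_ofD p lambda (SLval (h z0 * g)%g))
    (fun x y X Y => polar_of_bound p lambda g0M)
    (fun x X => form_of_bound p lambda g0M) K1 shear_indices a0_ge1 ra_le rb_le
    a1_ge0 alpha_le qa qb D_large E_large A_large A_xi q_pr q_den q_A
    (z0 := z0)).
  move=> z; rewrite inE => /asboolP[zbad _] v v_le y yE.
  rewrite -form_shear_change yE; apply: zbad.
  apply: (le_trans (l2norm_sup_le v_le)).
  apply: (@le_trans _ _ ((G * A)%N%:R)); last first.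
    by rewrite -natrX ler_nat mulnC leq_divM.
  by rewrite /G -!mulnA [leRHS]natrM ler_wpM2l // [leRHS]natrM ler_wpM2r.
have sub z : [set g : borelSL R n.+4 | X (h z * g)%g] `<=` K'.
  move=> g [_ [gM _]].
  have [h1 h2 h3] := hash_coef_bound i1 i2 A z q_pr (pivot_ge1 i0 alpha a D A)
    a1_ge0 alpha_le.
  exact: (unshear_bound shear_indices h1 h2 h3 gM).
have := sum_measure_le mu mK' (fun z => mX (h z)) sub mult.
under eq_bigr => z _ do rewrite (haar_translate haar (mX (h z))).
have -> : (\sum_(z : 'F_q * 'F_q) mu X = (q ^ 2)%N%:R%:E * mu X)%E.
  by rewrite sumr_const card_prod card_Fp // mulnn mule_natl.
rewrite kapE -lee_pdivlMl ?ltr0n ?expn_gt0 ?prime_gt0 // => /le_trans; apply.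
rewrite -!EFinM lee_fin.
have cN : (c * N ^ 2 <= 8 * G * E * D * q ^ 2)%N by exact: miss_count_bound.
rewrite ler_pdivlMr ?exprn_gt0 ?ltr0n // [leLHS](_ : _ =
  (c%:R * N%:R ^+ 2 * kap) / (q ^ 2)%N%:R); last by ring.
rewrite ler_pdivrMr ?ltr0n ?expn_gt0 ?prime_gt0 // [leRHS]mulrAC ler_wpM2r //.
by rewrite -natrX -!natrM ler_nat.
Qed.
End Averaging.

(** * Sign changes of indefinite forms along a line *)

Section Indefinite.
Context (R : realType) (n p : nat).
Implicit Types (lambda : R) (g : 'M[R]_n.+1).

Lemma form_of_opp lambda g x :
  form_of p (- lambda) g x = - form_of p lambda g x.
Proof. by rewrite /form_of mulNr. Qed.

Lemma form_of_basis lambda g (j : 'I_n.+1) : g \in unitmx ->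
  form_of p lambda g (delta_mx 0 j *m invmx g) =
  lambda * (if (j < p)%N then 1 else -1).
Proof.
move=> gu; rewrite /form_of mulmxKV // /std_form; congr (_ * _).
have E (P : pred 'I_n.+1) :
    \sum_(i < n.+1 | P i) (delta_mx 0 j : 'rV[R]_n.+1) 0 i ^+ 2 = (P j)%:R.
  rewrite big_mkcond (bigD1 j) //= big1 => [|i ij].
    by rewrite mxE !eqxx expr1n addr0; case: (P j).
  by rewrite mxE (negPf ij) andbF expr0n /= if_same.
by rewrite !E /=; case: ltnP => _; rewrite ?subr0 ?sub0r.
Qed.

Lemma polar_of_basis lambda g (j : 'I_n.+1) y : g \in unitmx ->
  polar_of p lambda g (delta_mx 0 j *m invmx g) y =
  lambda * ((if (j < p)%N then 1 else -1) * (y *m g) 0 j).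
Proof.
move=> gu; rewrite /polar_of mulmxKV //; congr (_ * _).
have E (P : pred 'I_n.+1) :
    \sum_(i < n.+1 | P i) (delta_mx 0 j : 'rV[R]_n.+1) 0 i * (y *m g) 0 i =
    (P j)%:R * (y *m g) 0 j.
  rewrite big_mkcond (bigD1 j) //= big1 => [|i ij].
    by rewrite mxE !eqxx addr0; case: (P j); rewrite ?mul0r.
  by rewrite mxE (negPf ij) andbF mul0r if_same.
by rewrite !E /=; case: ltnP => _; rewrite ?mul0r ?subr0 ?sub0r ?mulN1r ?mul1r.
Qed.

Lemma ex_pos_on_line lambda g x y : 0 < form_of p lambda g y ->
  exists s, 0 < form_of p lambda g (x + s *: y).
Proof.
move=> qy.
pose t := 1 + `|form_of p lambda g x| / form_of p lambda g y.
have t1 : 1 <= t by rewrite lerDl divr_ge0 // ltW.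
have tq : `|form_of p lambda g x| < t ^+ 2 * form_of p lambda g y.
  apply: (@lt_le_trans _ _ (t * form_of p lambda g y)).
    by rewrite /t mulrDl mul1r divfK ?gt_eqF // ltrDr.
  by rewrite ler_pM2r // expr2 ler_peMl //; lra.
have := ler_norm (- form_of p lambda g x); rewrite normrN => qx.
have t0 : 0 <= t by lra.
have [B0|/ltW B0] := leP 0 (polar_of p lambda g x y).
  exists t; rewrite form_ofD.
  have := mulr_ge0 t0 B0; move: (t ^+ 2 * _) tq; move: (form_of _ _ _ _) qx.
  by move: (polar_of _ _ _ _ _) => *; lra.
exists (- t); rewrite form_ofD sqrrN.
have := mulr_ge0_le0 t0 B0; move: (t ^+ 2 * _) tq; move: (form_of _ _ _ _) qx.
by move: (polar_of _ _ _ _ _) => *; lra.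
Qed.

(** Along a direction [e] of positive value, a form becomes positive from any
    starting point of negative value; the case of a negative value is the
    mirror image. In an isotropic direction the form is affine on lines, and it
    is not constant on some of them by non-degeneracy. *)
Lemma ex_sign_change lambda g (e : 'rV[R]_n.+1) : 0 < lambda ->
  g \in unitmx -> e != 0 -> (0 < p)%N -> (p <= n)%N ->
  exists x s, form_of p lambda g x < 0 < form_of p lambda g (x + s *: e).
Proof.
move=> l0 gu e0 p0 pn.
have [qe|qe|qe] := ltrgtP 0 (form_of p lambda g e).
- pose x : 'rV[R]_n.+1 := delta_mx 0 ord_max *m invmx g.
  have qx : form_of p lambda g x < 0.
    by rewrite form_of_basis //= ltnNge pn /= mulrN1 oppr_lt0.
  by have [s qs] := ex_pos_on_line x qe; exists x, s; rewrite qx.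
- pose y : 'rV[R]_n.+1 := delta_mx 0 ord0 *m invmx g.
  have qy : 0 < form_of p lambda g y by rewrite form_of_basis //= p0 mulr1.
  have qe' : 0 < form_of p (- lambda) g e by rewrite form_of_opp oppr_gt0.
  have [s] := ex_pos_on_line y qe'; rewrite form_of_opp oppr_gt0 => qs.
  exists (y + s *: e), (- s).
  by rewrite qs -addrA -scalerDl subrr scale0r addr0.
have [j uj] : exists j, (e *m g) 0 j != 0.
  apply/existsP; apply: contraNT e0 => /existsPn h.
  rewrite -(mulmxK gu e) (_ : e *m g = 0) ?mul0mx //.
  by apply/rowP => j; rewrite [RHS]mxE; apply/eqP; have := h j; rewrite negbK.
pose x : 'rV[R]_n.+1 := delta_mx 0 j *m invmx g.
have B0 : polar_of p lambda g x e != 0.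
  rewrite polar_of_basis //; apply: mulf_neq0; first by rewrite gt_eqF.
  apply: mulf_neq0 => //.
  by case: ifP => _; rewrite ?oppr_eq0 oner_neq0.
have val s : form_of p lambda g (x + s *: e) =
    form_of p lambda g x + 2 * s * polar_of p lambda g x e.
  by rewrite form_ofD -qe mulr0 addr0.
pose s1 := (- 1 - form_of p lambda g x) / (2 * polar_of p lambda g x e).
pose s2 := (1 - form_of p lambda g x) / (2 * polar_of p lambda g x e).
have v1 : form_of p lambda g (x + s1 *: e) = -1 by rewrite val /s1; field.
have v2 : form_of p lambda g (x + s2 *: e) = 1 by rewrite val /s2; field.
exists (x + s1 *: e), (s2 - s1).
by rewrite -addrA -scalerDl [s1 + _]addrC subrK v1 v2 ltrN10 ltr01.
Qed.

(** Rounding errors [w] are of lower order than [T ^ 2]. *)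
Lemma form_scaled_le lambda g y W : form_of p lambda g y < 0 ->
  exists T0 : nat, forall (T : nat) w, (T0 <= T)%N -> sup_le W w ->
  form_of p lambda g (w + T%:R *: y) <= -1.
Proof.
move=> qy; have [M M0 gM] : exists2 M, 0 <= M & forall i j, `|g i j| <= M.
  exists (\sum_i \sum_j `|g i j|) => [|i j].
    by rewrite !sumr_ge0 // => i _; rewrite sumr_ge0.
  rewrite (bigD1 i) //= (bigD1 j) //= -addrA lerDl addr_ge0 // ?sumr_ge0 //.
  by move=> k _; rewrite sumr_ge0.
have [Y Y0 hY] := ex_sup_le y.
set K := form_bound n lambda M; have K1 : 1 <= K := form_bound_ge1 _ _ _.
have [T0 hT0] := ex_nat_gt
  ((1 + K * W ^+ 2 + 2 * (K * W * Y)) / - form_of p lambda g y).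
exists T0.+1 => T w T_ge hw.
have W0 := sup_le_ge0 hw.
have /ler_normlP[_ h1] := form_of_bound p lambda gM hw.
have /ler_normlP[_ h2] := polar_of_bound p lambda gM hw hY.
rewrite -/K in h1 h2; rewrite form_ofD.
have T1 : 1 <= T%:R :> R by rewrite ler1n (leq_trans _ T_ge).
have hT : 1 + K * W ^+ 2 + 2 * (K * W * Y) <= T%:R * - form_of p lambda g y.
  rewrite -ler_pdivrMr ?oppr_gt0 // (le_trans (ltW hT0)) // ler_nat.
  by rewrite (leq_trans _ T_ge).
have K0 : 0 <= K by lra.
have a0 : 0 <= K * W ^+ 2 by rewrite mulr_ge0 ?sqr_ge0.
have b0 : 0 <= K * W * Y by rewrite !mulr_ge0.
move: (K * W ^+ 2) (K * W * Y) h1 h2 hT a0 b0 => k1 k2.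
move: (form_of _ _ _ w) (polar_of _ _ _ _ _) (form_of _ _ _ y) => qw B0 q0.
move=> h1 h2 hT a0 b0; clear - T1 h1 h2 hT a0 b0.
have T0 : 0 <= T%:R :> R by [].
have e1 : T%:R * B0 <= T%:R * k2 by rewrite ler_wpM2l.
have e2 : T%:R * (1 + k1 + 2 * k2) <= T%:R * (T%:R * - q0) by rewrite ler_wpM2l.
have e3 : k1 <= T%:R * k1 by rewrite ler_peMl.
by rewrite expr2; lra.
Qed.

(** Round a large multiple of the real sign change. *)
Lemma ex_integer_sign_change lambda g (j : 'I_n.+1) : 0 < lambda ->
  g \in unitmx -> (0 < p)%N -> (p <= n)%N ->
  exists (a : 'rV[int]_n.+1) (rho : int),
    form_of p lambda g (of_int a) <= -1 /\
    1 <= form_of p lambda g (of_int a + rho%:~R *: delta_mx 0 j).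
Proof.
move=> l0 gu p0 pn; set e : 'rV[R]_n.+1 := delta_mx 0 j.
have e0 : e != 0.
  apply/eqP => /matrixP/(_ 0 j); rewrite !mxE !eqxx /=; apply/eqP.
  exact: oner_neq0.
have [x [s /andP[qx qs]]] := ex_sign_change l0 gu e0 p0 pn.
have [T1 hT1] := form_scaled_le (2 : R) qx.
have qs' : form_of p (- lambda) g (x + s *: e) < 0.
  by rewrite form_of_opp oppr_lt0.
have [T2 hT2] := form_scaled_le (2 : R) qs'.
pose T := (T1 + T2)%N.
pose a : 'rV[int]_n.+1 := \row_i Num.floor (T%:R * x 0 i).
pose rho := Num.floor (T%:R * s).
have fl (z : R) : `|(Num.floor z)%:~R - z| <= 1.
  have /andP[] := floor_itv z; rewrite rmorphD /= => h1 h2.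
  by rewrite ler_norml; apply/andP; split; lra.
have w1 : sup_le 1 (of_int a - T%:R *: x) by move=> i; rewrite !mxE fl.
exists a, rho; split.
  rewrite -[of_int a](subrK (T%:R *: x)); apply: hT1; first exact: leq_addr.
  by apply: sup_le_trans w1; lra.
have w2 : sup_le 2 (of_int a - T%:R *: x + (rho%:~R - T%:R * s) *: e).
  apply: sup_le_trans (sup_leD w1 (sup_leZ _ (@sup_le_delta R n.+1 j))).
  by rewrite mulr1; have := fl (T%:R * s); rewrite -/rho; lra.
have := hT2 T _ (leq_addl _ _) w2.
rewrite form_of_opp lerN2 (_ : _ + T%:R *: _ = of_int a + rho%:~R *: e) //.
by rewrite scalerDr scalerA scalerBl addrACA subrK subrK.
Qed.

End Indefinite.

(** * All scales *)

(** Induction needs the sharper bound [2 - 1 / j] for the terms up to [j]. *)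
Lemma sum_inv_square_le (R : realType) (m : nat) :
  \sum_(k < m) (k%:R ^+ 2)^-1 <= 2 :> R.
Proof.
have key j : \sum_(k < j.+2) (k%:R ^+ 2)^-1 <= 2 - j.+1%:R^-1 :> R.
  elim: j => [|j IH].
    by rewrite !big_ord_recr big_ord0 /= expr0n /= invr0 expr1n invr1; lra.
  rewrite big_ord_recr /=; apply: le_trans (lerD IH (lexx _)) _.
  have j0 : 0 < j.+1%:R :> R by rewrite ltr0n.
  have -> : j.+2%:R = j.+1%:R + 1 :> R by rewrite natr1.
  move: (j.+1%:R) j0 => t t0.
  rewrite -subr_ge0 (_ : _ - _ = (t * (t + 1) ^+ 2)^-1); last first.
    by field; apply/andP; split; lra.
  by rewrite invr_ge0 mulr_ge0 ?sqr_ge0 // ltW.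
case: m => [|[|j]]; first by rewrite big_ord0.
  by rewrite big_ord1 expr0n invr0.
by apply: (le_trans (key j)); rewrite gerBl invr_ge0.
Qed.

Lemma measure_lim_sup_inv_square (d : measure_display) (T : measurableType d)
    (R : realType) (mu : {measure set T -> \bar R}) (F : (set T)^nat) (C : R)
    (N0 : nat) : (forall k, measurable (F k)) ->
  (forall N, (N0 <= N)%N -> (mu (F N) <= (C / N%:R ^+ 2)%:E)%E) -> 0 <= C ->
  mu (lim_sup_set F) = 0%E.
Proof.
move=> mF muF C0.
pose F' k := if (N0 <= k)%N then F k else set0.
have mF' k : measurable (F' k) by rewrite /F'; case: ifP.
have -> : lim_sup_set F = lim_sup_set F'.
  apply/seteqP; split => x hx k _.
    have [j /= kj Fj] := hx (maxn k N0) I; exists j => /=.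
      by apply: leq_trans kj; exact: leq_maxl.
    by rewrite /F' (leq_trans (leq_maxr k N0) kj).
  have [j /= kj] := hx k I; rewrite /F'; case: ifP => // _ Fj.
  by exists j.
apply: lim_sup_set_cvg0 => //.
apply: (@le_lt_trans _ _ (\sum_(k <oo) (C / k%:R ^+ 2)%:E)%E).
  apply: lee_nneseries => // k _; rewrite /F'; case: ifP => [/muF //|_].
  by rewrite measure0 lee_fin divr_ge0 ?sqr_ge0.
apply: (@le_lt_trans _ _ (C * 2)%:E); last exact: ltry.
apply: lime_le.
  by apply: is_cvg_nneseries => k _ _; rewrite lee_fin divr_ge0 ?sqr_ge0.
apply: nearW => m; rewrite sumEFin lee_fin big_mkord -mulr_sumr ler_wpM2l //.
exact: sum_inv_square_le.
Qed.

(** Borel-Cantelli on each of the countably many pieces, which cover the group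
    by [ex_integer_sign_change]. *)
Lemma bad_negligible (R : realType) (n p : nat) (lambda : R)
    (alpha : 'rV[R]_n.+4) (xi : R)
    (mu : {measure set (borelSL R n.+4) -> \bar R}) :
  haar_measure mu -> 0 < lambda -> (0 < p)%N -> (p <= n.+3)%N ->
  mu.-negligible (lim_sup_set (bad_set p lambda alpha xi)).
Proof.
move=> haar l0 p0 pn.
pose bad_piece (j : nat * 'rV[int]_n.+4 * int) (N : nat) :=
  bad_set p lambda alpha xi N `&`
  piece p lambda j.1.1%:R j.1.2 (line_point j.1.2 j.2).
have mbad_piece j N : measurable (bad_piece j N).
  have := measurableI _ _ (bad_set_measurable p lambda alpha xi N 1%g)
    (piece_measurable p lambda j.1.1%:R j.1.2 (line_point j.1.2 j.2) 1%g).
  by congr measurable; apply/seteqP; split => g /=; rewrite mul1g.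
have null j : mu.-negligible (lim_sup_set (bad_piece j)).
  apply/negligibleP.
    apply: bigcapT_measurable => k.
    by apply: bigcup_measurable => i _.
  have [C [N0 [C0 muN]]] :=
    measure_bad_piece p lambda alpha xi j.1.1%:R j.1.2 j.2 haar.
  exact: measure_lim_sup_inv_square (mbad_piece j) muN C0.
pose H k := if unpickle k is Some j then lim_sup_set (bad_piece j) else set0.
apply: (@negligibleS _ _ _ mu (\bigcup_k H k)); last first.
  apply: negligible_bigcup => k; rewrite /H; case: unpickle => // .
  exact: negligible_set0.
move=> g gbad.
have [a [rho [qa qb]]] := ex_integer_sign_change ord_max l0 (SL_unitmx g) p0 pn.
have [M hM] := ex_nat_gt (\sum_i \sum_j `|SLval g i j|).
pose j : nat * 'rV[int]_n.+4 * int := (M, a, rho).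
exists (pickle j) => //; rewrite /H pickleK => k _.
have [N kN gN] := gbad k I; exists N => //; split=> //; split => /=.
  move=> i i'; apply: le_trans (ltW hM).
  rewrite (bigD1 i) //= (bigD1 i') //= -addrA lerDl addr_ge0 // ?sumr_ge0 //.
  by move=> ? _; rewrite sumr_ge0.
by rewrite of_int_line_point.
Qed.

Lemma unif_le_dioph_exponent (R : realType) (n : nat) (alpha : 'rV[R]_n) :
  (unif_dioph_exponent alpha <= dioph_exponent alpha)%E.
Proof.
apply: le_ereal_sup => _ [nu [nu0 h] <-]; exists nu => //; split => // M.
have [t [[Mt t0] ht]] : exists t, (M < t /\ 0 < t) /\ dioph_solvable alpha nu t.
  apply: (@filter_ex _ (pinfty_nbhs R)).
  apply: filterI => //; apply: filterI; apply: nbhs_pinfty_gt; exact: num_real.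
by exists t.
Qed.

(** It suffices that [3 u <= 1 + u + u ^ 2 <= 1 + w + w u]. *)
Lemma critical_exponent_le (R : realType) (n : nat) (w u : R) :
  0 < u -> u <= w -> (0 < n)%N ->
  ((n%:R - 2) * u - 2) / (n%:R * (1 + w + w * u)) <= 1 / 3.
Proof.
move=> u0 uw n0; have n0' : 0 < n%:R :> R by rewrite ltr0n.
have h1 : 3 * u <= 1 + w + w * u.
  have : u * u <= w * u by rewrite ler_pM2r.
  have : 0 <= (u - 1) ^+ 2 := sqr_ge0 _.
  rewrite expr2; lra.
have d0 : 0 < n%:R * (1 + w + w * u) by rewrite mulr_gt0 //; lra.
rewrite ler_pdivrMr //.
have : n%:R * (3 * u) <= n%:R * (1 + w + w * u) by rewrite ler_pM2l.
lra.
Qed.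

(** Take for [N] the integer part of the cube root of [t]. *)
Lemma cube_scale (R : realType) (kappa t : R) (M0 : nat) :
  kappa <= 1 / 3 -> 1 <= t -> M0%:R ^+ 3 <= t ->
  exists N, [/\ (M0 <= N)%N, N%:R ^+ 3 <= t & N.+1%:R^-1 <= t `^ (- kappa)].
Proof.
move=> hk t1 Mt; have t0 : 0 <= t by lra.
pose y := t `^ (1 / 3).
have y0 : 0 <= y by exact: powR_ge0.
have y3 : y ^+ 3 = t.
  by rewrite -powR_mulrn // -powRrM mul1r mulVf ?powRr1 // pnatr_eq0.
have /andP[h1 h2] := truncn_itv y0.
exists (Num.truncn y); split.
- rewrite truncn_ge_nat // -(@ler_pXn2r _ 3) ?nnegrE // y3 //.
- by rewrite -y3 lerXn2r ?nnegrE.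
have ypos : 0 < y by rewrite powR_gt0; lra.
apply: (@le_trans _ _ (t `^ (- (1 / 3)))).
  by rewrite powRN lef_pV2 ?posrE ?ltr0n // ltW.
by rewrite ler_powR // lerN2.
Qed.

Theorem mainTheorem4 (R : realType) (n : nat) (hn : (5 <= n)%N)
    (alpha : 'rV[R]_n) (halpha : irrational_vector alpha)
    (homega : (dioph_exponent alpha < +oo)%E)
    (homegahat : ((2 / (n%:R - 2))%:E < unif_dioph_exponent alpha)%E)
    (kappa : R) (hkappa0 : 0 < kappa)
    (hkappa : let omega := fine (dioph_exponent alpha) in
      let omegahat := fine (unif_dioph_exponent alpha) in
      kappa < ((n%:R - 2) * omegahat - 2)
              / (n%:R * (1 + omega + omega * omegahat)))
    (xi : R) :
  almost_every_indefinite_form (fun Q : 'rV[R]_n -> R =>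
    \forall t \near +oo, exists v : 'rV[int]_n,
      `|shift_form Q alpha (of_int v) - xi| < t `^ (- kappa) /\
      l2norm (of_int v : 'rV[R]_n) <= t).
Proof.
have kappa_le : kappa <= 1 / 3.
  have n2 : 0 < 2 / (n%:R - 2) :> R.
    by rewrite divr_gt0 // subr_gt0 ltr_nat (leq_trans _ hn).
  have uw := unif_le_dioph_exponent alpha.
  have u0 : (0 < unif_dioph_exponent alpha)%E.
    by apply: lt_trans homegahat; rewrite lte_fin.
  have u_fin : unif_dioph_exponent alpha \is a fin_num.
    by rewrite ge0_fin_numE ?ltW //; exact: le_lt_trans homega.
  have w_fin : dioph_exponent alpha \is a fin_num.
    by rewrite ge0_fin_numE //; apply: le_trans (ltW u0) uw.
  apply: le_trans (ltW hkappa) _; apply: critical_exponent_le.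
  - by rewrite fine_gt0 // u0 /= (le_lt_trans uw).
  - exact: fine_le.
  - exact: leq_trans hn.
case: n hn alpha {halpha homega homegahat hkappa}
  => [|[|[|[|[|n]]]]] // _ alpha.
move=> p1 p2 p1_gt0 p2_gt0 p12 lambda lambda_gt0 mu haar.
have p1_le : (p1 <= n.+4)%N by rewrite -ltnS -p12 -addn1 leq_add2l.
apply: negligibleS (bad_negligible alpha xi haar lambda_gt0 p1_gt0 p1_le).
move=> g gnot M0 _; apply: contrapT => no_bad; apply: gnot.
near=> t.
have [||N [MN Nt tN]] := @cube_scale R kappa t M0 kappa_le.
- by near: t; apply: nbhs_pinfty_ge; exact: num_real.
- by near: t; apply: nbhs_pinfty_ge; exact: num_real.
have : ~ bad_set p1 lambda alpha xi N g by move=> bad; apply: no_bad; exists N.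
move=> /existsNP[v /not_implyP[v_le /negP]]; rewrite -ltNge => v_small.
by exists v; split; [exact: lt_le_trans v_small tN|exact: le_trans Nt].
Unshelve. all: by end_near. Qed.
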